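(* Let $(L,E)$ be a tree with amplitude matrices $(\psi_{xy}(i,j))$ given for every edge, and suppose that $|\psi_{xy}(i,j)|^2=\frac1d$ for all $x\sim y$ and all $1\le i,j\le d$. Then the state $\varphi$ on $\mathcal B_L$ determined by $$\varphi(a)=\frac1d\lim_{\Lambda\uparrow L}\langle\psi_\Lambda,a\,\psi_\Lambda\rangle,\qquad a\in\mathcal B_{L,\mathrm{loc}}$$ (limit over finite connected subsets $\Lambda\subseteq L$ increasing to $L$) is a generalized quantum Markov state.
   Context: Graphs: $(L,E)$ is a non-oriented simple graph with $L$ non-empty and at most countable; $x\sim y$ means $\{x,y\}\in E$. All graphs are connected and locally finite. A tree is a connected graph without loops (cycles). For finite $\Lambda\subseteq L$: $\vec\partial\Lambda=\{x\in L\setminus\Lambda:\ x\sim y\text{ for some }y\in\Lambda\}$, $\overline\Lambda=\Lambda\cup\vec\partial\Lambda$, and $\Lambda\subset\subset\Lambda'$ means $\overline\Lambda\subset\Lambda'$. Complements are in $L$. Algebras: fix $d\in\mathbb N$. To each $x\in L$ is associated a Hilbert space $\mathcal H_x$ of dimension $d$ with a fixed orthonormal basis $e_1(x),\dots,e_d(x)$. For finite $\Lambda$, $\mathcal H_\Lambda=\bigotimes_{x\in\Lambda}\mathcal H_x$, $\mathcal B_\Lambda=\mathcal B(\mathcal H_\Lambda)$. $\mathcal B_L$ is the $C^*$-inductive limit of the $\mathcal B_\Lambda$ (the infinite $C^*$-tensor product of the $\mathcal B_x=\mathcal B(\mathcal H_x)$), $\mathcal B_{L,\mathrm{loc}}=\bigcup_{\Lambda\text{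 finite}}\mathcal B_\Lambda$, and for arbitrary $I\subseteq L$, $\mathcal B_I$ is the $C^*$-subalgebra $\bigotimes_{x\in I}\mathcal B_x$ of $\mathcal B_L$. For $\omega_\Lambda:\Lambda\to\{1,\dots,d\}$ put $e_{\omega_\Lambda}=\bigotimes_{x\in\Lambda}e_{\omega_\Lambda(x)}(x)$. Amplitude matrices: for each edge $\{x,y\}$, a complex $d\times d$ matrix $(\psi_{xy}(i,j))$ with $\sum_{i}|\psi_{xy}(i,j)|^2=1$ for all $j$ and $\sum_{j}|\psi_{xy}(i,j)|^2=1$ for all $i$; first index refers to $x$, second to $y$, with $\psi_{yx}(j,i)=\psi_{xy}(i,j)$. For finite $\Lambda$, with $E_\Lambda=\{\{x,y\}:x,y\in\Lambda,\ x\sim y\}$, $$\psi_\Lambda=\sum_{\omega_\Lambda}\Big(\prod_{\{x,y\}\in E_\Lambda}\psi_{xy}(\omega_\Lambda(x),\omega_\Lambda(y))\Big)e_{\omega_\Lambda}\in\mathcal H_\Lambda .$$ For a tree the limit defining $\varphi$ exists for every local $a$ and $\varphi$ is a state on $\mathcal B_L$. Quasi-conditional expectation: for unital $C^*$-algebras $\mathcal C\subset\mathcal B\subset\mathcal A$, a quasi-conditional expectation with respect to the triple is a completely positive identity-preserving linear map $\mathcal E:\mathcal A\to\mathcal B$ with $\mathcal E(ca)=c\,\mathcal E(a)$ for all $a\in\mathcal A$, $c\in\mathcal C$. Generalized quantum Markov state: a state $\varphi$ on $\mathcal B_L$ is a generalized quantum Markov state if there exist an increasing sequence of finite sets $\Lambda_n\uparrow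 L$ ($n\ge1$, with $\Lambda_0=\emptyset$) such that $\Lambda_n\subset\subset\Lambda_{n+1}$ and, for each $n$, a quasi-conditional expectation $\mathcal E_{\Lambda_n^c}$ with respect to the triple $\mathcal B_{(\overline\Lambda_n)^c}\subseteq\mathcal B_{\Lambda_n^c}\subseteq\mathcal B_{\Lambda_{n-1}^c}$ and a state $\hat\varphi_{\Lambda_n^c}$ on $\mathcal B_{\Lambda_n^c}$ such that for every $n$ $$\hat\varphi_{\Lambda_n^c}\big|_{\mathcal B_{\Lambda_{n+1}\setminus\Lambda_n}}=\hat\varphi_{\Lambda_{n+1}^c}\circ\mathcal E_{\Lambda_{n+1}^c}\big|_{\mathcal B_{\Lambda_{n+1}\setminus\Lambda_n}}$$ and $$\varphi=\lim_{n\to\infty}\hat\varphi_{\Lambda_n^c}\circ\mathcal E_{\Lambda_n^c}\circ\mathcal E_{\Lambda_{n-1}^c}\circ\cdots\circ\mathcal E_{\Lambda_1^c}$$ in the weak-$*$ topology. *)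

(* Defs.v *)
From HB Require Import structures.
From mathcomp Require Import all_boot all_order all_algebra finmap complex.
From mathcomp Require Import boolp classical_sets functions cardinality reals.
From mathcomp Require Import topology normedtype.

Set Implicit Arguments.
Unset Strict Implicit.
Unset Printing Implicit Defensive.

Import Order.TTheory GRing.Theory Num.Theory.
Import numFieldNormedType.Exports.

Local Open Scope classical_set_scope.
Local Open Scope ring_scope.
Local Open Scope complex_scope.
Local Open Scope sesquilinear_scope.

(* Unital C*-algebras.  The norm is a real-valued function of its own: the
   hierarchy has no common substructure of normed modules and algebras, so a
   type cannot be canonically both. *)
HB.mixin Record isCstarAlgebra (R : realType) A of GRing.Algebra R[i] A := {
  star : A -> A;
  cnorm : A -> R;
  starK : involutive star;
  starD : {morph star : a b / a + b};
  starZ : forall (k : R[i]) a, star (k *: a) = k^* *: star a;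
  starM : forall a b, star (a * b) = star b * star a;
  cnorm_eq0 : forall a, cnorm a = 0 -> a = 0;
  cnormD_le : forall a b, cnorm (a + b) <= cnorm a + cnorm b;
  cnormZ : forall (k : R[i]) a, (cnorm (k *: a))%:C = `|k| * (cnorm a)%:C;
  cnormM_le : forall a b, cnorm (a * b) <= cnorm a * cnorm b;
  cnorm_starM : forall a, cnorm (star a * a) = cnorm a ^+ 2;
  cnorm_complete : forall u : nat -> A,
    (forall eps, 0 < eps -> \forall m & n \near \oo, cnorm (u m - u n) < eps) ->
    exists l, (fun n => cnorm (u n - l)) @ \oo --> (0 : R)
}.

#[short(type="cstarAlgType")]
HB.structure Definition CstarAlgebra (R : realType) :=
  { A of isCstarAlgebra R A & GRing.Algebra R[i] A }.

(* C*-subalgebras of an ambient C*-algebra are represented by their carrier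
   sets, and maps between them by functions on the ambient algebra whose values
   outside the domain are irrelevant. *)
Section Cstar.
Variables (R : realType) (A : cstarAlgType R).

Definition norm_closure (X : set A) : set A :=
  [set a | forall eps : R, 0 < eps -> exists2 b, X b & cnorm (a - b) < eps].

(* Positive elements of M_n(B), i.e. those of the form c^* c. *)
Definition mx_positive (B : set A) n (a : 'M[A]_n) : Prop :=
  exists2 c : 'M[A]_n, (forall i j, B (c i j)) & a = c ^t star *m c.

Record is_state (B : set A) (f : A -> R[i]) : Prop := IsState {
  state_linear : forall (k : R[i]) a b,
    B a -> B b -> f (k *: a + b) = k * f a + f b;
  state_unit : f 1 = 1;
  state_positive : forall b, B b -> 0 <= f (star b * b)
}.

(* With respect to the triple C, B, D, where C is contained in B and B in D. *)
Record quasi_conditional_expectation (C B D : set A) (E : A -> A) : Prop :=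
  QuasiConditionalExpectation {
  qce_maps : forall a, D a -> B (E a);
  qce_linear : forall (k : R[i]) a b,
    D a -> D b -> E (k *: a + b) = k *: E a + E b;
  qce_unit : E 1 = 1;
  qce_cp : forall n (a : 'M[A]_n), mx_positive D a -> mx_positive B (map_mx E a);
  qce_module : forall c a, C c -> D a -> E (c * a) = c * E a
}.

End Cstar.

Section Graphs.
Variables (L : countType) (e : rel L).

Definition connected_in (S : {pred L}) : Prop :=
  forall x y, x \in S -> y \in S ->
  exists p, [/\ path e x p, all (mem S) p & last x p = y].

Record is_tree : Prop := IsTree {
  tree_nonempty : inhabited L;
  tree_sym : symmetric e;
  tree_irr : irreflexive e;
  tree_locally_finite : forall x, finite_set [set y | e x y];
  tree_connected : connected_in predT;
  tree_acyclic : forall c : seq L, (2 < size c)%N -> ~ ucycle e c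
}.

Definition boundary (Lam : {fset L}) : set L :=
  [set x | x \notin Lam /\ exists2 y, y \in Lam & e x y].

Definition gclosure (Lam : {fset L}) : set L := [set` Lam] `|` boundary Lam.

End Graphs.

Section TensorProduct.
Variables (R : realType) (L : countType) (d : nat).
Implicit Types Lam : {fset L}.

Definition config Lam := {ffun Lam -> 'I_d}.

Definition hdim Lam := #|{: config Lam}|.

(* H_Lam, in the basis e_w indexed by the enumeration of the configurations w. *)
Definition hilb Lam := 'cV[R[i]]_(hdim Lam).

Definition bnd Lam := 'M[R[i]]_(hdim Lam).

Definition inner Lam (u v : hilb Lam) : R[i] := (u ^t* *m v) 0 0.

Definition restrict_config Lam Lam' (s : (Lam `<=` Lam')%fset)
    (w : config Lam') : config Lam := [ffun x => w (fincl s x)].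

(* The inclusion a |-> a (x) 1 of B_Lam in B_Lam'. *)
Definition tensor1 Lam Lam' (s : (Lam `<=` Lam')%fset) (a : bnd Lam) :
    bnd Lam' :=
  \matrix_(i, j)
    let w : config Lam' := enum_val i in
    let w' : config Lam' := enum_val j in
    if [forall x : Lam', (val x \notin Lam) ==> (w x == w' x)]
    then a (enum_rank (restrict_config s w)) (enum_rank (restrict_config s w'))
    else 0.

(* A, with the maps iota, is the C*-inductive limit of the B_Lam; this
   determines A up to a *-isomorphism intertwining the maps iota. *)
Record is_inductive_limit (A : cstarAlgType R)
    (iota : forall Lam, bnd Lam -> A) : Prop := IsInductiveLimit {
  iota_linear : forall Lam, linear (iota Lam);
  iota_monoid : forall Lam, monoid_morphism (iota Lam);
  iota_star : forall Lam (a : bnd Lam), iota Lam (a ^t*) = star (iota Lam a);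
  iota_inj : forall Lam, injective (iota Lam);
  iota_tensor1 : forall Lam Lam' (s : (Lam `<=` Lam')%fset) (a : bnd Lam),
    iota Lam' (tensor1 s a) = iota Lam a;
  iota_dense : norm_closure (\bigcup_Lam range (iota Lam)) = [set: A]
}.

(* B_I *)
Definition subalg (A : cstarAlgType R) (iota : forall Lam, bnd Lam -> A)
    (I : set L) : set A :=
  norm_closure
    (\bigcup_(Lam in [set Lam : {fset L} | [set` Lam] `<=` I]) range (iota Lam)).

End TensorProduct.

Section States.
Variables (R : realType) (L : countType) (e : rel L) (d : nat).
Implicit Types Lam : {fset L}.

Record is_amplitude (psi : L -> L -> 'M[R[i]]_d) : Prop := IsAmplitude {
  amplitude_col : forall x y j, e x y -> \sum_i `|psi x y i j| ^+ 2 = 1;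
  amplitude_row : forall x y i, e x y -> \sum_j `|psi x y i j| ^+ 2 = 1;
  amplitude_sym : forall x y i j, e x y -> psi y x j i = psi x y i j
}.

(* Each edge of Lam occurs once in the product: pickle selects one of its two
   orientations, and by amplitude_sym the choice is immaterial. *)
Definition psi_vec (psi : L -> L -> 'M[R[i]]_d) Lam : hilb R d Lam :=
  \col_i let w : config d Lam := enum_val i in
    \prod_(p : Lam * Lam | e (val p.1) (val p.2)
                           && (choice.pickle (val p.1) < choice.pickle (val p.2))%N)
      psi (val p.1) (val p.2) (w p.1) (w p.2).

(* phi(a) = 1/d lim <psi_Lam, a psi_Lam> for all local a, the limit being that
   of the net of finite connected sets Lam, directed by inclusion. *)
Definition local_limit (psi : L -> L -> 'M[R[i]]_d) (A : cstarAlgType R)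
    (iota : forall Lam, bnd R d Lam -> A) (phi : A -> R[i]) : Prop :=
  forall Lam0 (a : bnd R d Lam0) (eps : R), 0 < eps ->
  exists2 Lam1 : {fset L}, connected_in e (mem Lam1) /\ (Lam0 `<=` Lam1)%fset &
  forall Lam (s : (Lam0 `<=` Lam)%fset),
    connected_in e (mem Lam) -> (Lam1 `<=` Lam)%fset ->
    `|d%:R^-1 * inner (psi_vec psi Lam) (tensor1 s a *m psi_vec psi Lam)
      - phi (iota Lam0 a)| < eps%:C.

(* E_n o ... o E_1 *)
Fixpoint iter_qce (A : Type) (E : nat -> A -> A) (n : nat) (a : A) : A :=
  if n is n'.+1 then E n (iter_qce E n' a) else a.

(* E n and f n stand for E_(Lam_n^c) and \hat\phi_(Lam_n^c); they matter for
   n > 0 only. *)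
Definition generalized_quantum_markov (A : cstarAlgType R)
    (iota : forall Lam, bnd R d Lam -> A) (phi : A -> R[i]) : Prop :=
  let B := subalg iota in
  exists (Lam : nat -> {fset L}) (E : nat -> A -> A) (f : nat -> A -> R[i]),
  [/\ [/\ Lam 0%N = fset0,
          forall n, (Lam n `<=` Lam n.+1)%fset,
          forall x, exists n, x \in Lam n
        & forall n, gclosure e (Lam n) `<=` [set` Lam n.+1]],
      forall n, quasi_conditional_expectation
        (B (~` gclosure e (Lam n.+1))) (B (~` [set` Lam n.+1]))
        (B (~` [set` Lam n])) (E n.+1),
      forall n, is_state (B (~` [set` Lam n.+1])) (f n.+1),
      forall n a, B ([set` Lam n.+2] `\` [set` Lam n.+1]) a ->
        f n.+1 a = f n.+2 (E n.+2 a)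
    & forall a, (fun n => f n (iter_qce E n a) : R[i]^o) @ \oo
                --> (phi a : R[i]^o)].

End States.

(* Main.v *)
Require Import Defs.
From mathcomp Require Import all_boot all_order all_algebra finmap complex.
From mathcomp Require Import boolp classical_sets functions cardinality reals.
From mathcomp Require Import topology normedtype sequences ring lra.

Set Implicit Arguments.
Unset Strict Implicit.
Unset Printing Implicit Defensive.

Import Order.TTheory GRing.Theory Num.Theory.
Import numFieldNormedType.Exports.

Local Open Scope classical_set_scope.
Local Open Scope ring_scope.
Local Open Scope complex_scope.

(** The amplitudes have constant modulus, so psi_Lam is, up to a scalar, the image of
    the product vector h with equal coordinates under a diagonal unitary U_Lam, the
    product over the edges of Lam of commuting two-site phases.  Thus phi is a
    product state in disguise: phi (c) is the limit of <h, U_Lam^* c U_Lam h>, and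
    in particular phi (c) = 0 as soon as P_Lam U_Lam^* c U_Lam P_Lam = 0 for all
    large balls Lam, where P_Lam is the projection onto h ([state_eq0]).

    The regions of the Markov structure are the balls B_n around a vertex, and W_n
    denotes the unitary U of the ball B_(n+1), which contains every edge that meets
    B_n.  The states are f_n (b) = phi (W_n b W_n^* ).  The expectation E_(n+1)
    conjugates with V = W_n^* W_(n+1) and then takes the partial expectation over
    B_(n+1) in the state h; its values lie outside B_(n+1) ([slice_outside]), and it
    is linear over the elements supported away from the support of V and of the
    Kraus operators, the closure of B_(n+1).  The identity f_n = f_(n+1) o E_(n+1)
    holds on the whole algebra ([hat_state_expectation]): compression by P_Lam undoes
    the partial expectation ([slice_compress]), and the phases that are not in W_(n+1)
    do not touch B_(n+1) and commute with its projection ([phase_ratio_comm]).  As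
    W_0 = 1, the compositions f_n o E_n o ... o E_1 all equal phi, so that their
    limit is trivial.

    Complete positivity requires that a sum of squares of matrices be one square,
    with entries in a prescribed C*-subalgebra ([sum_squares_square]).  The square
    root is the limit of an iteration ([sqrt_one_sub]) whose convergence needs a
    submultiplicative bound on matrices over A for which 1 - S / t is a contraction.
    This bound is the operator norm for the semi-inner product that a state defines
    on columns over A.  It controls the C*-norm of the entries because the
    representation defined by a state is isometric ([state_norm]): a matrix algebra
    has only one C*-norm, and local elements are dense.  Conversely the C*-norm
    bounds the operator norm ([positive_functional_bound]), by the same square root
    iteration in dimension 1. *)

(** * Norm convergence in a C*-algebra *)

Section CstarNorm.
Variables (R : realType) (A : cstarAlgType R).
Implicit Types (a b c : A) (u v : nat -> A).

Lemma star0 : star (0 : A) = 0.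
Proof. by apply: (addrI (star (0 : A))); rewrite -starD !addr0. Qed.

Lemma starN a : star (- a) = - star a.
Proof. by apply: (addrI (star a)); rewrite -starD !subrr star0. Qed.

Lemma starB a b : star (a - b) = star a - star b.
Proof. by rewrite starD starN. Qed.

Lemma star1 : star (1 : A) = 1.
Proof.
by have := starM (star (1 : A)) 1; rewrite mulr1 starK mulr1 => <-.
Qed.

Lemma star_sum (I : Type) (r : seq I) (P : pred I) (F : I -> A) :
  star (\sum_(i <- r | P i) F i) = \sum_(i <- r | P i) star (F i).
Proof. exact: (big_morph _ (@starD R A) star0). Qed.

Lemma cnorm0 : cnorm (0 : A) = 0.
Proof.
by apply: complexI; rewrite -[in LHS](scale0r (0 : A)) cnormZ normr0 mul0r.
Qed.

Lemma cnormN a : cnorm (- a) = cnorm a.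
Proof. by apply: complexI; rewrite -scaleN1r cnormZ normrN1 mul1r. Qed.

Lemma cnorm_ge0 a : 0 <= cnorm a.
Proof.
have := cnormD_le a (- a); rewrite subrr cnorm0 cnormN => h; lra.
Qed.

Lemma cnorm_distC a b : cnorm (a - b) = cnorm (b - a).
Proof. by rewrite -cnormN opprB. Qed.

Lemma cnorm_dist_trans c a b : cnorm (a - b) <= cnorm (a - c) + cnorm (c - b).
Proof. by have := cnormD_le (a - c) (c - b); rewrite addrA subrK. Qed.

Lemma cnorm_sum_le (I : Type) (r : seq I) (P : pred I) (F : I -> A) :
  cnorm (\sum_(i <- r | P i) F i) <= \sum_(i <- r | P i) cnorm (F i).
Proof.
elim/big_rec2: _ => [|i x a _ h]; first by rewrite cnorm0.
by apply: le_trans (cnormD_le _ _) _; rewrite lerD2l.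
Qed.

Lemma cnormZR (k : R) a : cnorm (k%:C *: a) = `|k| * cnorm a.
Proof. 
apply: complexI; rewrite cnormZ rmorphM /=; congr (_ * _).
by rewrite normc_def /= expr0n addr0 sqrtr_sqr.
Qed.

Lemma starZR (k : R) a : star (k%:C *: a) = k%:C *: star a.
Proof. by rewrite starZ; congr (_ *: _); exact: conjc_real. Qed.

Lemma starZi a : star ('i%C *: a) = - 'i%C *: star a.
Proof.
rewrite starZ; congr (_ *: _); apply/eqP.
by rewrite eq_complex /= oppr0 !eqxx.
Qed.

Lemma cnorm_star a : cnorm (star a) = cnorm a.
Proof.
have le_star b : cnorm b <= cnorm (star b).
  have [->|nb] := eqVneq (cnorm b) 0; first exact: cnorm_ge0.
  have b0 : 0 < cnorm b by rewrite lt_neqAle eq_sym nb cnorm_ge0.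
  have := cnormM_le (star b) b.
  by rewrite cnorm_starM expr2 ler_pM2r.
by apply/eqP; rewrite eq_le le_star andbT -{2}(starK a) le_star.
Qed.

Definition cconv u a := (fun n => cnorm (u n - a)) @ \oo --> (0 : R).

Lemma cconv_squeeze u a (r : nat -> R) :
  (forall n, cnorm (u n - a) <= r n) -> r @ \oo --> (0 : R) -> cconv u a.
Proof.
move=> ur r0; apply: (squeeze_cvgr _ (cvg_cst 0) r0).
by near=> n; rewrite cnorm_ge0 ur.
Unshelve. all: by end_near. Qed.

Lemma cconv_cst a : cconv (fun=> a) a.
Proof. by apply: cconv_squeeze (cvg_cst 0) => n; rewrite subrr cnorm0. Qed.

Let cvg0D (r s : nat -> R) : r @ \oo --> (0 : R) -> s @ \oo --> (0 : R) ->
  (fun n => r n + s n) @ \oo --> (0 : R).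
Proof. by move=> r0 s0; rewrite -[0 : R]addr0; apply: cvgD. Qed.

Lemma cconvD u v a b : cconv u a -> cconv v b -> cconv (fun n => u n + v n) (a + b).
Proof.
move=> ua vb; apply: cconv_squeeze (cvg0D ua vb) => n.
by rewrite opprD addrACA cnormD_le.
Qed.

Lemma cconvM u v a b : cconv u a -> cconv v b -> cconv (fun n => u n * v n) (a * b).
Proof.
move=> ua vb.
set r : nat -> R := fun n =>
  cnorm (u n - a) * (cnorm (v n - b) + cnorm b) + cnorm a * cnorm (v n - b).
apply: (@cconv_squeeze _ _ r).
  move=> n; have -> : u n * v n - a * b = (u n - a) * v n + a * (v n - b).
    by rewrite mulrBl mulrBr addrA subrK.
  apply: le_trans (cnormD_le _ _) _; rewrite lerD ?cnormM_le //.
  apply: le_trans (cnormM_le _ _) _; rewrite ler_wpM2l ?cnorm_ge0 //.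
  by have := cnormD_le (v n - b) b; rewrite subrK.
have -> : (0 : R) = 0 * (0 + cnorm b) + cnorm a * 0 by ring.
by apply: cvgD; apply: cvgM => //; [apply: cvgD => // |]; exact: cvg_cst.
Qed.

Lemma cconv_star u a : cconv u a -> cconv (fun n => star (u n)) (star a).
Proof.
by move=> ua; apply: (cconv_squeeze _ ua) => n; rewrite -starB cnorm_star.
Qed.

Lemma cconvS u a : cconv u a -> cconv (fun n => u n.+1) a.
Proof. by move=> ua; rewrite /cconv (cvg_shiftS (fun n => cnorm (u n - a))). Qed.

Lemma cconv_sum (I : Type) (r : seq I) (P : pred I) (u : I -> nat -> A) (a : I -> A) :
  (forall i, P i -> cconv (u i) (a i)) ->
  cconv (fun n => \sum_(i <- r | P i) u i n) (\sum_(i <- r | P i) a i).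
Proof.
move=> ua; elim: r => [|i r IH].
  by under [X in cconv X]funext do rewrite big_nil; rewrite big_nil; exact: cconv_cst.
under [X in cconv X]funext do rewrite big_cons.
by rewrite big_cons; case: ifP => // Pi; apply: cconvD => //; exact: ua.
Qed.

Lemma cconv_unique u a b : cconv u a -> cconv u b -> a = b.
Proof.
move=> ua ub; apply/eqP; rewrite -subr_eq0; apply/eqP/cnorm_eq0.
have h : (fun _ : nat => cnorm (a - b)) @ \oo --> (0 : R).
  apply: (squeeze_cvgr _ (cvg_cst 0) (cvg0D ua ub)).
  near=> n; rewrite cnorm_ge0 /= (le_trans (cnorm_dist_trans (u n) a b)) //.
  by rewrite cnorm_distC.
by rewrite -(cvg_lim (@Rhausdorff R) h) lim_cst.
Unshelve. all: by end_near. Qed.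

(** Completeness, in the form in which it serves iterative schemes: increments
    dominated by those of a bounded increasing real sequence. *)
Lemma cconv_dominated u (r : nat -> R) :
  (forall n, cnorm (u n.+1 - u n) <= r n.+1 - r n) -> (forall n, r n <= 1) ->
  exists a, cconv u a.
Proof.
move=> ur r1; apply: cnorm_complete.
have umn k n : cnorm (u (n + k)%N - u n) <= r (n + k)%N - r n.
  elim: k => [|k IH]; first by rewrite addn0 !subrr cnorm0.
  rewrite addnS; apply: le_trans (cnorm_dist_trans (u (n + k)%N) _ _) _.
  by have := ur (n + k)%N; lra.
have r_incr : {homo r : n m / (n <= m)%N >-> n <= m}.
  move=> n m /subnKC <-; have := le_trans (cnorm_ge0 _) (umn (m - n)%N n).
  by rewrite subr_ge0.
have has_r : has_sup (range r).
  by split; [exists (r 0%N); exists 0%N | exists 1 => _ [n _ <-]].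
move=> eps eps0; have [_ [N _ <-] rN] := sup_adherent eps0 has_r.
have rN_le n : r n <= sup (range r).
  by apply: ub_le_sup; [case: has_r | exists n].
exists ([set n | (N <= n)%N], [set n | (N <= n)%N]); first by split; exists N.
case=> m n [/= Nm Nn]; wlog nm : m n Nm Nn / (n <= m)%N.
  move=> h; have [/h|/ltnW/h] := leqP n m; first exact.
  by rewrite cnorm_distC; exact.
have := umn (m - n)%N n; rewrite subnKC // => /le_lt_trans; apply.
by have := r_incr _ _ Nn; have := rN_le m; lra.
Qed.

Record closed_star_subalgebra (B : set A) : Prop := ClosedStarSubalgebra {
  csub_1 : B 1;
  csub_linear : forall (k : R[i]) a b, B a -> B b -> B (k *: a + b);
  csub_mul : forall a b, B a -> B b -> B (a * b);
  csub_star : forall a, B a -> B (star a);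
  csub_lim : forall u a, (forall n, B (u n)) -> cconv u a -> B a
}.

Section Closed.
Variables (B : set A) (Bc : closed_star_subalgebra B).

Lemma csub_0 : B 0.
Proof.
by have := csub_linear Bc (-1) (csub_1 Bc) (csub_1 Bc); rewrite scaleN1r addNr.
Qed.

Lemma csub_D a b : B a -> B b -> B (a + b).
Proof. by move=> Ba Bb; have := csub_linear Bc 1 Ba Bb; rewrite scale1r. Qed.

Lemma csub_Z (k : R[i]) a : B a -> B (k *: a).
Proof. by move=> Ba; have := csub_linear Bc k Ba csub_0; rewrite addr0. Qed.

Lemma csub_N a : B a -> B (- a).
Proof. by move=> Ba; rewrite -scaleN1r; apply: csub_Z. Qed.

Lemma csub_sum (I : Type) (r : seq I) (P : pred I) (F : I -> A) :
  (forall i, P i -> B (F i)) -> B (\sum_(i <- r | P i) F i).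
Proof. by move=> BF; apply: big_ind => //; [exact: csub_0 | exact: csub_D]. Qed.

End Closed.

Lemma csub_setT : closed_star_subalgebra [set: A].
Proof. by []. Qed.

End CstarNorm.

(** * Square roots of matrices over a C*-algebra *)

Section SquareRoot.
Variables (R : realType) (A : cstarAlgType R) (n : nat).
Implicit Types X Y Z : 'M[A]_n.

(** The C*-algebraic adjoint, also for rectangular matrices, where columns play the
    role of vectors. *)
Definition adj m p (Y : 'M[A]_(m, p)) : 'M[A]_(p, m) := \matrix_(i, j) star (Y j i).

Lemma adjE m p (Y : 'M[A]_(m, p)) : adj Y = map_mx star Y^T.
Proof. by apply/matrixP => i j; rewrite !mxE. Qed.

Lemma adjK m p : cancel (@adj m p) (@adj p m).
Proof. by move=> Y; apply/matrixP => i j; rewrite !mxE starK. Qed.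

Lemma adjD m p (Y Z : 'M[A]_(m, p)) : adj (Y + Z) = adj Y + adj Z.
Proof. by apply/matrixP => i j; rewrite !mxE starD. Qed.

Lemma adjB m p (Y Z : 'M[A]_(m, p)) : adj (Y - Z) = adj Y - adj Z.
Proof. by apply/matrixP => i j; rewrite !mxE starB. Qed.

Lemma adj_sum m p (I : finType) (F : I -> 'M[A]_(m, p)) :
  adj (\sum_i F i) = \sum_i adj (F i).
Proof.
apply/matrixP => i j; rewrite !mxE !summxE star_sum.
by apply: eq_bigr => k _; rewrite !mxE.
Qed.

Lemma adjM m p q (Y : 'M[A]_(m, p)) (Z : 'M[A]_(p, q)) :
  adj (Y *m Z) = adj Z *m adj Y.
Proof.
apply/matrixP => i j; rewrite !mxE star_sum; apply: eq_bigr => k _.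
by rewrite !mxE starM.
Qed.

Lemma adj1 m : adj (1%:M : 'M[A]_m) = 1%:M.
Proof.
by apply/matrixP => i j; rewrite !mxE eq_sym; case: eqP => _; rewrite ?star1 ?star0.
Qed.

Lemma adj_scalar (a : A) m : adj (a%:M : 'M[A]_m) = (star a)%:M.
Proof.
by apply/matrixP => i j; rewrite !mxE eq_sym; case: eqP => _; rewrite ?star0.
Qed.

(* [bound Y r] stands for the inequality of a submultiplicative norm of Y and
   r; no such norm is at hand on matrices over A. *)
Variable bound : 'M[A]_n -> R -> Prop.
Hypothesis bound0 : bound 0 0.
Hypothesis boundD : forall Y Z r s, bound Y r -> bound Z s -> bound (Y + Z) (r + s).
Hypothesis boundM : forall Y Z r s,
  bound Y r -> bound Z s -> bound (Y *m Z) (r * s).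
Hypothesis bound_half : forall Y r, bound Y r -> bound (2^-1%:A *: Y) (r / 2).
Hypothesis bound_entry : forall Y r i j, bound Y r -> cnorm (Y i j) <= r.

(** The solution of 2 p = x + p^2 with p small satisfies (1 - p)^2 = 1 - x, and the
    iteration of p |-> (x + p^2) / 2 from 0 is majorized step by step by the same
    iteration for x = 1, whose values increase and stay below 1.  Hence bound 1 is
    enough, and p inherits being self-adjoint and having entries in B. *)
Theorem sqrt_one_sub (B : set A) X : closed_star_subalgebra B ->
  (forall i j, B (X i j)) -> adj X = X -> bound X 1 ->
  exists Z, [/\ forall i j, B (Z i j), adj Z = Z & Z *m Z = 1%:M - X].
Proof.
move=> Bc BX Xh X1.
pose h : A := 2^-1%:A.
have hstar : star h = h by rewrite /h starZ star1 fmorphV rmorph_nat.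
pose fix p k := if k is k'.+1 then h *: (X + p k' *m p k') else 0 : 'M[A]_n.
pose fix r k : R := if k is k'.+1 then (1 + r k' ^+ 2) / 2 else 0.
have r0 k : 0 <= r k by elim: k => [|k IH] //=; have := sqr_ge0 (r k); lra.
have r1 k : r k <= 1 by elim: k => [|k IH] //=; have := r0 k; nra.
have p_bound k : bound (p k) (r k).
  elim: k => [|k IH] //=; apply: bound_half; apply: boundD => //.
  by rewrite expr2; apply: boundM.
have r_incr k : 0 <= r k.+1 - r k.
  elim: k => [|k IH]; first by rewrite subr0.
  have -> : r k.+2 - r k.+1 = (r k.+1 - r k) * (r k.+1 + r k) / 2 by rewrite /=; field.
  by have := r0 k; have := r0 k.+1; nra.
have dp_bound k : bound (p k.+1 - p k) (r k.+1 - r k).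
  elim: k => [|k IH].
    by rewrite !subr0; apply: (p_bound 1%N).
  have -> : p k.+2 - p k.+1 =
      h *: ((p k.+1 - p k) *m p k.+1 + p k *m (p k.+1 - p k)).
    rewrite -[p k.+2]/(h *: (X + p k.+1 *m p k.+1)).
    rewrite -[p k.+1 in X in _ - X]/(h *: (X + p k *m p k)).
    rewrite -scalerBr; congr (_ *: _).
    by rewrite opprD addrACA subrr add0r mulmxBl mulmxBr addrA subrK.
  have -> : r k.+2 - r k.+1 =
      ((r k.+1 - r k) * r k.+1 + r k * (r k.+1 - r k)) / 2 by rewrite /=; field.
  by apply: bound_half; apply: boundD; apply: boundM.
have plim i j : exists a, cconv (fun k => p k i j) a.
  apply: (cconv_dominated (r := r)) => // k.
  by have := bound_entry i j (dp_bound k); rewrite !mxE.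
pose P : 'M[A]_n := \matrix_(i, j) projT1 (cid (plim i j)).
have pP i j : cconv (fun k => p k i j) (P i j).
  by rewrite mxE; case: (cid _).
have Bp k i j : B (p k i j).
  elim: k i j => [|k IH] i j /=; first by rewrite mxE; apply: csub_0.
  rewrite !mxE; apply: csub_mul => //.
    by apply: csub_Z => //; apply: csub_1.
  apply: csub_D => //; rewrite ?mxE; apply: csub_sum => // l _.
  exact: csub_mul.
have ph k : adj (p k) = p k.
  elim: k => [|k IH].
    by apply/matrixP => i j; rewrite !mxE star0.
  rewrite -[p k.+1]/(h *: (X + p k *m p k)).
  have : adj (X + p k *m p k) = X + p k *m p k by rewrite adjD adjM IH Xh.
  move: (X + _) => Y Yh; apply/matrixP => i j.
  rewrite mxE [in LHS]mxE [in RHS]mxE -[in RHS]Yh [adj Y i j]mxE starM hstar.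
  by rewrite /h -scalerAl -scalerAr mul1r mulr1.
have Ph : adj P = P.
  apply/matrixP => i j; apply: cconv_unique (pP i j).
  rewrite [adj P i j]mxE; have := cconv_star (pP j i).
  rewrite (_ : (fun k => star (p k j i)) = fun k => p k i j) //.
  by apply: funext => k; rewrite -[in RHS]ph mxE.
have PE : P = h *: (X + P *m P).
  apply/matrixP => i j; apply: cconv_unique (cconvS (pP i j)) _.
  have entryE (Y : 'M[A]_n) :
      (h *: (X + Y *m Y)) i j = h * (X i j + \sum_l Y i l * Y l j).
    by rewrite [LHS]mxE [X in _ * X]mxE [X in _ * (_ + X)]mxE.
  rewrite entryE; under eq_fun => k do rewrite [p k.+1]/(h *: (X + p k *m p k)) entryE.
  apply: cconvM; [exact: cconv_cst | apply: cconvD; first exact: cconv_cst].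
  by apply: cconv_sum => l _; apply: cconvM.
have PPE : P + P = X + P *m P.
  have half2 : 2^-1 + 2^-1 = 1 :> R[i] by field.
  rewrite [in LHS]PE -scalerDl /h -scalerDl half2.
  by rewrite !scale1r.
exists (1%:M - P); split.
- move=> i j; rewrite [X in B X]mxE [X in _ + X]mxE; apply: csub_D => //.
    by rewrite mxE; case: eqP => _; [exact: csub_1 | exact: csub_0].
  by apply: csub_N => //; apply: (csub_lim Bc _ (pP i j)).
- by rewrite adjB adj1 Ph.
- rewrite mulmxBl mul1mx mulmxBr mulmx1.
  have -> : X = P + P - P *m P by rewrite PPE addrK.
  by rewrite !opprD opprK !addrA.
Qed.

End SquareRoot.

(** * The semi-inner product of a positive functional *)

(** Only real parts of the values of a state matter for norm estimates, and real
    bilinear forms have a simpler Cauchy-Schwarz inequality. *)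
Record positive_functional (R : realType) (A : cstarAlgType R) (f : A -> R) :
    Prop := PositiveFunctional {
  pfD : {morph f : a b / a + b};
  pfZ : forall (t : R) a, f (t%:C *: a) = t * f a;
  pf_star : forall a, f (star a) = f a;
  pf_ge0 : forall a, 0 <= f (star a * a)
}.

Section PositiveFunctional.
Variables (R : realType) (A : cstarAlgType R) (f : A -> R).
Hypothesis f_pos : positive_functional f.

Let fD := pfD f_pos.
Let fZ := pfZ f_pos.
Let f_star := pf_star f_pos.
Let f_ge0 := pf_ge0 f_pos.

Lemma pf0 : f 0 = 0.
Proof. by have := fZ 0 0; rewrite mul0r scaler0. Qed.

Let f0 := pf0.

Let fN a : f (- a) = - f a.
Proof. by apply/eqP; rewrite -addr_eq0 -fD addNr f0. Qed.

Lemma pf_sum (I : Type) (r : seq I) (P : pred I) (F : I -> A) :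
  f (\sum_(i <- r | P i) F i) = \sum_(i <- r | P i) f (F i).
Proof. exact: (big_morph f fD f0). Qed.

Let f_sum := pf_sum.

Section Form.
Variable n : nat.
Implicit Types (u v w : 'cV[A]_n) (X Y S : 'M[A]_n).

Definition form X u v : R := f ((adj u *m X *m v) 0 0).

Lemma formDl X u v w : form X (u + v) w = form X u w + form X v w.
Proof. by rewrite /form adjD !mulmxDl mxE fD. Qed.

Lemma formDr X u v w : form X u (v + w) = form X u v + form X u w.
Proof. by rewrite /form !mulmxDr mxE fD. Qed.

Lemma formD X Y u v : form (X + Y) u v = form X u v + form Y u v.
Proof. by rewrite /form mulmxDr mulmxDl mxE fD. Qed.

Lemma form_adj X u v : form (adj X) u v = form X v u.
Proof.
rewrite /form (_ : adj u *m adj X *m v = adj (adj v *m X *m u)) ?mxE ?f_star //.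
by rewrite !adjM adjK mulmxA.
Qed.

Definition rscale (t : R) m p (Y : 'M[A]_(m, p)) : 'M[A]_(m, p) :=
  map_mx (fun a => t%:C *: a) Y.

Lemma rscale_mull t m p s (Y : 'M[A]_(m, p)) (Z : 'M[A]_(p, s)) :
  rscale t Y *m Z = rscale t (Y *m Z).
Proof.
apply/matrixP => i j; rewrite !mxE scaler_sumr; apply: eq_bigr => k _.
by rewrite !mxE scalerAl.
Qed.

Lemma rscale_mulr t m p s (Y : 'M[A]_(m, p)) (Z : 'M[A]_(p, s)) :
  Y *m rscale t Z = rscale t (Y *m Z).
Proof.
apply/matrixP => i j; rewrite !mxE scaler_sumr; apply: eq_bigr => k _.
by rewrite !mxE scalerAr.
Qed.

Lemma adj_rscale t m p (Y : 'M[A]_(m, p)) : adj (rscale t Y) = rscale t (adj Y).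
Proof. by apply/matrixP => i j; rewrite !mxE starZR. Qed.

Lemma formZr t X u v : form X u (rscale t v) = t * form X u v.
Proof. by rewrite /form rscale_mulr mxE fZ. Qed.

Lemma formZl t X u v : form X (rscale t u) v = t * form X u v.
Proof. by rewrite /form adj_rscale !rscale_mull mxE fZ. Qed.

Lemma formZ t X u v : form (rscale t X) u v = t * form X u v.
Proof. by rewrite /form rscale_mulr rscale_mull mxE fZ. Qed.

Lemma formM X Y Z u v : form X (Y *m u) (Z *m v) = form (adj Y *m X *m Z) u v.
Proof. by rewrite /form adjM !mulmxA. Qed.

Lemma form1_ge0 u : 0 <= form 1%:M u u.
Proof.
rewrite /form mulmx1 mxE f_sum; apply: sumr_ge0 => i _.
by rewrite mxE f_ge0.
Qed.

Lemma form_square_ge0 Y u : 0 <= form (adj Y *m Y) u u.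
Proof. by have := form1_ge0 (Y *m u); rewrite formM mulmx1. Qed.

Lemma form_cauchy_schwarz X u v : adj X = X -> (forall w, 0 <= form X w w) ->
  form X u v ^+ 2 <= form X u u * form X v v.
Proof.
move=> Xh X0; have E t : 0 <= form X u u + 2 * t * form X u v + t ^+ 2 * form X v v.
  apply: le_trans (X0 (u + rscale t v)) _.
  rewrite !(formDl, formDr, formZl, formZr) -[form X v u]form_adj Xh; lra.
move: (form X u u) (form X u v) (form X v v) (X0 u) (X0 v) E => a b c a0 c0 E.
have [c_eq0|c_neq0] := eqVneq c 0.
  rewrite c_eq0 mulr0 in E *.
  have [->|b0] := eqVneq b 0; first by rewrite expr0n.
  (* for c = 0 an affine function of t is nonnegative, which forces b = 0 *)
  have := E (- (a + 1) / (2 * b)); rewrite mulr0 addr0.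
  have -> : 2 * (- (a + 1) / (2 * b)) * b = - (a + 1) by field.
  by lra.
have cpos : 0 < c by rewrite lt_neqAle eq_sym c_neq0.
(* the minimum of the quadratic polynomial *)
have := E (- b / c).
have -> : a + 2 * (- b / c) * b + (- b / c) ^+ 2 * c = (a * c - b ^+ 2) / c by field.
by rewrite pmulr_lge0 ?invr_gt0 // subr_ge0.
Qed.

Definition qnorm u : R := form 1%:M u u.

Lemma qnorm_mul Y u : qnorm (Y *m u) = form (adj Y *m Y) u u.
Proof. by rewrite /qnorm formM mulmx1. Qed.

Lemma form1_le u v : form 1%:M u v <= Num.sqrt (qnorm u) * Num.sqrt (qnorm v).
Proof.
rewrite -sqrtrM ?form1_ge0 //; apply: le_trans (ler_norm _) _.
rewrite -sqrtr_sqr ler_wsqrtr //.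
by apply: form_cauchy_schwarz; [exact: adj1 | exact: form1_ge0].
Qed.

(** Y has norm at most r on the Hilbert space obtained from the columns over A
    and the semi-inner product [form 1%:M]. *)
Definition opbound Y (r : R) := 0 <= r /\ forall u, qnorm (Y *m u) <= r ^+ 2 * qnorm u.

Lemma opbound0 : opbound 0 0.
Proof.
split=> // u; rewrite mul0mx /qnorm /form mulmx0 mxE f0.
by rewrite mulr_ge0 ?sqr_ge0 ?form1_ge0.
Qed.

Lemma opboundM Y Z r s : opbound Y r -> opbound Z s -> opbound (Y *m Z) (r * s).
Proof.
move=> [r0 Yr] [s0 Zs]; split=> [|u]; first exact: mulr_ge0.
rewrite -mulmxA exprMn -mulrA; apply: le_trans (Yr _) _.
by rewrite ler_wpM2l ?sqr_ge0.
Qed.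

Lemma opboundD Y Z r s : opbound Y r -> opbound Z s -> opbound (Y + Z) (r + s).
Proof.
move=> [r0 Yr] [s0 Zs]; split=> [|u]; first exact: addr_ge0.
have sqrt_le (T : 'M[A]_n) t : 0 <= t -> qnorm (T *m u) <= t ^+ 2 * qnorm u ->
    Num.sqrt (qnorm (T *m u)) <= t * Num.sqrt (qnorm u).
  move=> t0 /ler_wsqrtr /le_trans; apply.
  by rewrite sqrtrM ?sqr_ge0 // sqrtr_sqr ger0_norm.
rewrite mulmxDl /qnorm formDl !formDr -[form _ (Z *m u) (Y *m u)]form_adj adj1.
rewrite -!/(qnorm _).
have h := form1_le (Y *m u) (Z *m u).
have := le_trans h (ler_pM (sqrtr_ge0 _) (sqrtr_ge0 _)
  (sqrt_le _ _ r0 (Yr u)) (sqrt_le _ _ s0 (Zs u))).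
have -> : r * Num.sqrt (qnorm u) * (s * Num.sqrt (qnorm u)) =
    r * s * Num.sqrt (qnorm u) ^+ 2 by ring.
rewrite sqr_sqrtr ?form1_ge0 //.
have := Yr u; have := Zs u; lra.
Qed.

Lemma opbound_rscale (t : R) Y r : 0 <= t -> opbound Y r -> opbound (rscale t Y) (t * r).
Proof.
move=> t0 [r0 Yr]; split=> [|u]; first exact: mulr_ge0.
have := ler_wpM2l (sqr_ge0 t) (Yr u).
by rewrite rscale_mull exprMn /qnorm formZl formZr !mulrA -expr2.
Qed.

(** |Y^* u|^2 = <u, Y Y^* u> <= |u| r |Y^* u|. *)
Lemma opbound_adj Y r : opbound Y r -> opbound (adj Y) r.
Proof.
move=> [r0 Yr]; split=> // u; set v := adj Y *m u.
have v0 : 0 <= qnorm v by exact: form1_ge0.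
have h : qnorm v <= Num.sqrt (qnorm u) * (r * Num.sqrt (qnorm v)).
  rewrite {1}(_ : qnorm v = form 1%:M u (Y *m v)); last first.
    by rewrite qnorm_mul adjK /form mulmx1 !mulmxA.
  apply: le_trans (form1_le _ _) _; rewrite ler_wpM2l ?sqrtr_ge0 //.
  apply: le_trans (ler_wsqrtr (Yr v)) _.
  by rewrite sqrtrM ?sqr_ge0 // sqrtr_sqr ger0_norm.
have := sqr_sqrtr v0; have := sqr_sqrtr (form1_ge0 u : 0 <= qnorm u).
have := sqrtr_ge0 (qnorm u); have := sqrtr_ge0 (qnorm v).
move: h; move: (Num.sqrt (qnorm u)) (Num.sqrt (qnorm v)) => x y h y0 x0 xE yE.
have y_le : y <= r * x.
  have [->|y_neq0] := eqVneq y 0; first exact: mulr_ge0.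
  have ypos : 0 < y by rewrite lt_neqAle eq_sym y_neq0.
  by rewrite -(ler_pM2r ypos); nra.
by rewrite -xE -yE -exprMn ler_sqr ?nnegrE ?mulr_ge0.
Qed.

(** Apply the Cauchy-Schwarz inequality of the form <u, X v> to u and X u: it gives
    |X u|^4 <= <u, X u> <X u, X X u> <= |u|^2 |X u|^2. *)
Lemma opbound_positive X : adj X = X -> (forall u, 0 <= form X u u) ->
  (forall u, form X u u <= qnorm u) -> opbound X 1.
Proof.
move=> Xh X0 X1; split=> // u; rewrite expr1n mul1r.
have h := form_cauchy_schwarz u (X *m u) Xh X0.
have E : form X u (X *m u) = qnorm (X *m u).
  by rewrite qnorm_mul Xh /form !mulmxA.
rewrite E in h; have q0 := form1_ge0 (X *m u).
have [//|lt] := leP (qnorm (X *m u)) (qnorm u).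
have qpos : 0 < qnorm (X *m u) by apply: le_lt_trans lt; apply: form1_ge0.
have := X0 u; have := X1 u; have := X1 (X *m u) => h1 h2 h3.
have h4 : form X u u * form X (X *m u) (X *m u) <= qnorm u * qnorm (X *m u).
  by apply: ler_pM => //; apply: X0.
by have := le_trans h h4; rewrite expr2 ler_pM2r // leNgt lt.
Qed.

End Form.

Lemma col_qnorm n (u : 'cV[A]_n) : qnorm u = \sum_i f (star (u i 0) * u i 0).
Proof.
by rewrite /qnorm /form mulmx1 mxE f_sum; apply: eq_bigr => i _; rewrite mxE.
Qed.

Let scalar_mulE a (u : 'cV[A]_1) : ((a%:M : 'M_1) *m u) 0 0 = a * u 0 0.
Proof. by rewrite mxE big_ord1 mxE eqxx. Qed.

Lemma opbound_scalar a (r : R) : 0 <= r ->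
  (forall b, f (star (a * b) * (a * b)) <= r ^+ 2 * f (star b * b)) ->
  opbound (a%:M : 'M_1) r.
Proof. by move=> r0 ar; split=> // u; rewrite !col_qnorm !big_ord1 scalar_mulE. Qed.

Lemma opbound_scalar_le a (r : R) b : opbound (a%:M : 'M_1) r ->
  f (star (a * b) * (a * b)) <= r ^+ 2 * f (star b * b).
Proof.
move=> [_ /(_ (b%:M : 'M_1))].
by rewrite !col_qnorm !big_ord1 scalar_mulE !mxE eqxx.
Qed.

(** In dimension 1, [sqrt_one_sub] applies with the C*-norm as bound: if
    [cnorm a <= r] then r^2 - a^* a is the square of a self-adjoint element, so
    that f (b^* (r^2 - a^* a) b) >= 0. *)
Lemma positive_functional_bound a b r : cnorm a <= r ->
  f (star (a * b) * (a * b)) <= r ^+ 2 * f (star b * b).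
Proof.
move=> ar; have r0 := le_trans (cnorm_ge0 a) ar.
have [r_eq0|r_neq0] := eqVneq r 0.
  have -> : a = 0.
    by apply: cnorm_eq0; apply/eqP; rewrite eq_le cnorm_ge0 andbT -r_eq0.
  by rewrite mul0r mulr0 f0 mulr_ge0 ?sqr_ge0.
have rpos : 0 < r by rewrite lt_neqAle eq_sym r_neq0.
pose x : 'M[A]_1 := ((r ^- 2)%:C *: (star a * a))%:M.
have x_bound : cnorm (x 0 0) <= 1.
  rewrite mxE mulr1n cnormZR cnorm_starM ger0_norm ?invr_ge0 ?sqr_ge0 //.
  rewrite mulrC ler_pdivrMr ?exprn_gt0 // mul1r.
  by rewrite ler_pXn2r // nnegrE cnorm_ge0.
pose bound (Y : 'M[A]_1) s := cnorm (Y 0 0) <= s.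
have [|||||||z [_ zh zE]] :=
  @sqrt_one_sub R A 1 bound _ _ _ _ _ setT x (csub_setT A) _ _ x_bound => //.
- by rewrite /bound mxE cnorm0.
- move=> Y Z s t Ys Zt; rewrite /bound mxE.
  by apply: le_trans (cnormD_le _ _) _; apply: lerD.
- move=> Y Z s t Ys Zt; rewrite /bound mxE big_ord1.
  by apply: le_trans (cnormM_le _ _) _; apply: ler_pM => //; exact: cnorm_ge0.
- move=> Y s Ys; rewrite /bound mxE -scalerAl mul1r.
  have -> : 2^-1 = (2^-1 : R)%:C by rewrite fmorphV rmorph_nat.
  by rewrite cnormZR ger0_norm ?invr_ge0 // mulrC ler_pM2r ?invr_gt0.
- by move=> Y s i j; rewrite !ord1.
- apply/matrixP => i j; rewrite !ord1 !mxE mulr1n starZR starM starK //.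
have := f_ge0 (z 0 0 * b).
have zE' : star (z 0 0) * z 0 0 = 1 - (r ^- 2)%:C *: (star a * a).
  have := congr1 (fun Y : 'M[A]_1 => Y 0 0) zE; rewrite !mxE big_ord1 !mulr1n => <-.
  by congr (_ * _); rewrite -[in RHS]zh mxE.
rewrite starM mulrA -(mulrA (star b)) zE' mulrBr mulr1 mulrBl fD fN.
rewrite -scalerAr -scalerAl fZ starM !mulrA subr_ge0 mulrC.
by rewrite ler_pdivrMr ?exprn_gt0 // [_ * r ^+ 2]mulrC.
Qed.

(** When the C*-norm is the operator norm of the representation defined by f,
    matrices over A may be estimated on the semi-inner product space of columns. *)
Hypothesis f_norm : forall a r, 0 <= r ->
  (forall b, f (star (a * b) * (a * b)) <= r ^+ 2 * f (star b * b)) ->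
  cnorm a <= r.

Section SumOfSquares.
Variable n : nat.
Implicit Types (Y Z : 'M[A]_n) (u v : 'cV[A]_n).

(** Restrict the operator to the columns supported at j and keep the i-th
    coordinate of the image. *)
Lemma opbound_entry Y r i j : opbound Y r -> cnorm (Y i j) <= r.
Proof.
move=> [r0 Yr]; apply: f_norm => // b.
have := Yr (\col_k (if k == j then b else 0)); rewrite !col_qnorm.
rewrite [X in _ <= _ * X -> _](bigD1 j) //= !mxE eqxx [X in _ * (_ + X)]big1; last first.
  by move=> k kj; rewrite mxE (negPf kj) mulr0 f0.
rewrite addr0; apply: le_trans; rewrite (bigD1 i) //= !mxE.
have -> : \sum_k Y i k * (\col_k (if k == j then b else 0) : 'cV_n) k 0 = Y i j * b.
  rewrite (bigD1 j) //= mxE eqxx big1 ?addr0 // => k kj.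
  by rewrite mxE (negPf kj) mulr0.
by rewrite lerDl sumr_ge0.
Qed.

Lemma opbound_exists Y : exists r, opbound Y r.
Proof.
have unit_bound i j (a : A) : opbound (a *: delta_mx i j : 'M_n) (cnorm a).
  split=> [|u]; first exact: cnorm_ge0.
  rewrite !col_qnorm (bigD1 i) //= big1 ?addr0 => [|k ki].
    rewrite (_ : ((a *: delta_mx i j) *m u) i 0 = a * u j 0).
      apply: le_trans (positive_functional_bound _ (lexx _)) _.
      rewrite ler_wpM2l ?sqr_ge0 // (bigD1 j) //= lerDl sumr_ge0 //.
    rewrite mxE (bigD1 j) //= !mxE !eqxx mulr1 big1 ?addr0 // => k kj.
    by rewrite !mxE eqxx (negPf kj) mulr0 mul0r.
  rewrite (_ : ((a *: delta_mx i j) *m u) k 0 = 0) ?mulr0 ?f0 //.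
  by rewrite mxE big1 // => l _; rewrite !mxE (negPf ki) mulr0 mul0r.
have -> : Y = \sum_i \sum_j (Y i j *: delta_mx i j).
  by rewrite -matrix_sum_delta.
apply: (big_ind (fun Z => exists r, opbound Z r)) => [|Z1 Z2 [r r1] [s s2]|i _].
- by exists 0; apply: opbound0.
- by exists (r + s); apply: opboundD.
apply: (big_ind (fun Z => exists r, opbound Z r)) => [|Z1 Z2 [r r1] [s s2]|j _].
- by exists 0; apply: opbound0.
- by exists (r + s); apply: opboundD.
by exists (cnorm (Y i j)).
Qed.

(** Only the sum S has its entries in B, so it is S that a root is taken of: for t
    large, 1 - S / t is a positive contraction, hence S / t = 1 - (1 - S / t) has a
    square root over B. *)
Theorem sum_squares_square (B : set A) (I : finType) (y : I -> 'M[A]_n) :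
  closed_star_subalgebra B ->
  (forall i j, B ((\sum_k adj (y k) *m y k) i j)) ->
  exists2 Z : 'M[A]_n, forall i j, B (Z i j) &
    \sum_k adj (y k) *m y k = adj Z *m Z.
Proof.
set S := \sum_k _ => Bc BS.
have Sh : adj S = S.
  by rewrite adj_sum; apply: eq_bigr => k _; rewrite adjM adjK.
have S0 u : 0 <= form S u u.
  rewrite /form mulmx_sumr mulmx_suml summxE f_sum; apply: sumr_ge0 => k _.
  exact: form_square_ge0.
have [r [r0 Sr]] := opbound_exists S.
have t0 : 0 < r + 1 by lra.
pose t := r + 1; pose X : 'M[A]_n := 1%:M + rscale (- t^-1) S.
have formX u : form X u u = qnorm u - t^-1 * form S u u.
  by rewrite formD formZ mulNr.
have Xh : adj X = X by rewrite /X adjD adj1 adj_rscale Sh.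
have S_le u : form S u u <= r * qnorm u.
  have -> : form S u u = form 1%:M u (S *m u) by rewrite /form mulmx1 mulmxA.
  apply: le_trans (form1_le _ _) _.
  have := ler_wsqrtr (Sr u); rewrite sqrtrM ?sqr_ge0 // sqrtr_sqr ger0_norm // => h.
  apply: le_trans (ler_wpM2l (sqrtr_ge0 _) h) _.
  by rewrite mulrCA -expr2 sqr_sqrtr ?form1_ge0.
have X1 : opbound X 1.
  apply: opbound_positive => // u; rewrite formX.
    rewrite subr_ge0 mulrC ler_pdivrMr // mulrC; apply: le_trans (S_le u) _.
    by rewrite ler_wpM2r ?form1_ge0 // /t; lra.
  by rewrite gerBl mulr_ge0 // invr_ge0 ltW.
have BX i j : B (X i j).
  rewrite [X i j]mxE; apply: csub_D => //.
    by rewrite mxE; case: eqP => _; [exact: csub_1 | exact: csub_0].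
  by rewrite mxE; apply: csub_Z.
have half Y s : opbound Y s -> opbound (2^-1%:A *: Y) (s / 2).
  move=> Ys; have -> : 2^-1%:A *: Y = rscale 2^-1 Y.
    apply/matrixP => i j; rewrite !mxE -scalerAl mul1r; congr (_ *: _).
    by rewrite fmorphV rmorph_nat.
  by rewrite mulrC; apply: opbound_rscale; rewrite ?invr_ge0.
have [Z [BZ Zh ZE]] := sqrt_one_sub (opbound0 n) (@opboundD n) (@opboundM n) half
  opbound_entry Bc BX Xh X1.
exists (rscale (Num.sqrt t) Z).
  by move=> i j; rewrite mxE; apply: csub_Z.
rewrite adj_rscale rscale_mull rscale_mulr Zh ZE /X opprD addrA subrr add0r.
apply/matrixP => i j; rewrite !mxE scalerN -scalerN -scaleNr !scalerA.
rewrite -!rmorphN -!rmorphM /= opprK -expr2 sqr_sqrtr ?ltW //.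
by rewrite divff ?gt_eqF // scale1r.
Qed.

End SumOfSquares.
End PositiveFunctional.

(** * The C*-norm of the inductive limit as an operator norm *)

Section InductiveLimit.
Variables (R : realType) (L : countType) (d : nat).
Variables (A : cstarAlgType R) (iota : forall Lam : {fset L}, bnd R d Lam -> A).
Hypothesis A_lim : is_inductive_limit iota.
Implicit Types (Lam Gam : {fset L}) (I : set L).

Lemma iota1 Lam : iota (1%:M : bnd R d Lam) = 1.
Proof. by case: (iota_monoid A_lim Lam). Qed.

Lemma iotaM Lam (a b : bnd R d Lam) : iota (a *m b) = iota a * iota b.
Proof. by case: (iota_monoid A_lim Lam) => _ ->. Qed.

Lemma iotaP Lam (k : R[i]) (a b : bnd R d Lam) :
  iota (k *: a + b) = k *: iota a + iota b.
Proof. exact: (iota_linear A_lim). Qed.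

Lemma iota0 Lam : iota (0 : bnd R d Lam) = 0.
Proof.
by have := iotaP (-1) (0 : bnd R d Lam) 0; rewrite scaler0 addr0 scaleN1r addNr.
Qed.

Lemma iotaD Lam (a b : bnd R d Lam) : iota (a + b) = iota a + iota b.
Proof. by have := iotaP 1 a b; rewrite !scale1r. Qed.

Lemma iotaZ Lam (k : R[i]) (a : bnd R d Lam) : iota (k *: a) = k *: iota a.
Proof. by have := iotaP k a 0; rewrite !addr0 iota0 addr0. Qed.

Lemma iota_sum Lam (J : Type) (r : seq J) (P : pred J) (F : J -> bnd R d Lam) :
  iota (\sum_(i <- r | P i) F i) = \sum_(i <- r | P i) iota (F i).
Proof. exact: (big_morph _ (@iotaD Lam) (iota0 Lam)). Qed.

Definition local_alg Lam : set A := range (@iota Lam).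

Lemma loc_mono Lam Gam : (Lam `<=` Gam)%fset -> local_alg Lam `<=` local_alg Gam.
Proof.
by move=> s _ [m _ <-]; exists (tensor1 s m) => //; rewrite (iota_tensor1 A_lim).
Qed.

Lemma loc_1 Lam : local_alg Lam 1.
Proof. by exists 1%:M => //; rewrite iota1. Qed.

Lemma loc_linear Lam (k : R[i]) a b :
  local_alg Lam a -> local_alg Lam b -> local_alg Lam (k *: a + b).
Proof. by move=> [m _ <-] [m' _ <-]; exists (k *: m + m') => //; rewrite iotaP. Qed.

Lemma loc_mul Lam a b : local_alg Lam a -> local_alg Lam b -> local_alg Lam (a * b).
Proof. by move=> [m _ <-] [m' _ <-]; exists (m *m m') => //; rewrite iotaM. Qed.

Lemma loc_star Lam a : local_alg Lam a -> local_alg Lam (star a).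
Proof.
by move=> [m _ <-]; exists (map_mx Num.conj m^T) => //; rewrite (iota_star A_lim).
Qed.

Lemma loc_sum Lam (J : Type) (r : seq J) (P : pred J) (F : J -> A) :
  (forall i, P i -> local_alg Lam (F i)) -> local_alg Lam (\sum_(i <- r | P i) F i).
Proof.
move=> lF; apply: big_ind => //; first by exists 0; rewrite ?iota0.
by move=> a b la lb; have := loc_linear 1 la lb; rewrite scale1r.
Qed.

Definition loc_in I : set A :=
  \bigcup_(Lam in [set Lam : {fset L} | [set` Lam] `<=` I]) local_alg Lam.

Lemma loc_in_common I a b : loc_in I a -> loc_in I b ->
  exists2 Lam : {fset L}, [set` Lam] `<=` I & local_alg Lam a /\ local_alg Lam b.
Proof.
move=> [Lam sL la] [Gam sG lb]; exists (Lam `|` Gam)%fset.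
  by move=> x /=; rewrite inE => /orP[/sL|/sG].
by split; [apply: loc_mono la | apply: loc_mono lb]; rewrite ?fsubsetUl ?fsubsetUr.
Qed.

Lemma cconv_near (u : nat -> A) a eps : 0 < eps -> cconv u a ->
  exists n, cnorm (u n - a) < eps.
Proof.
move=> eps0 ua; have /cvgrPdist_lt/(_ _ eps0)[n _ un] := ua; exists n.
by have := un n (leqnn n); rewrite /= sub0r normrN ger0_norm ?cnorm_ge0.
Qed.

Lemma norm_closure_seq (X : set A) a : norm_closure X a ->
  exists2 u : nat -> A, forall n, X (u n) & cconv u a.
Proof.
move=> Xa; have h n := Xa n.+1%:R^-1 (@harmonic_gt0 R n).
exists (fun n => projT1 (cid2 (h n))) => [n|]; first by case: cid2.
apply: cconv_squeeze (@cvg_harmonic R) => n.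
by case: cid2 => b _ /= /ltW; rewrite cnorm_distC.
Qed.

Lemma seq_norm_closure (X : set A) (u : nat -> A) a : (forall n, X (u n)) ->
  cconv u a -> norm_closure X a.
Proof.
move=> Xu ua eps eps0; have [n un] := cconv_near eps0 ua.
by exists (u n); rewrite // cnorm_distC.
Qed.

Lemma subset_norm_closure (X : set A) : X `<=` norm_closure X.
Proof. by move=> a Xa; apply: seq_norm_closure (cconv_cst a). Qed.

Lemma subalgE I : subalg iota I = norm_closure (loc_in I).
Proof. by []. Qed.

(** Two local elements supported in I have a common finite support in I, so the
    algebraic operations can be carried out on approximating sequences. *)
Lemma subalg_closed I : closed_star_subalgebra (subalg iota I).
Proof.
rewrite subalgE; split.
- apply: subset_norm_closure; exists fset0; last exact: loc_1.
  by move=> x /=; rewrite inE.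
- move=> k a b /norm_closure_seq[u lu ua] /norm_closure_seq[v lv vb].
  apply: (seq_norm_closure (u := fun n => (k%:A * u n) + v n)); last first.
    have -> : k *: a + b = k%:A * a + b by rewrite -scalerAl mul1r.
    by apply: cconvD => //; apply: cconvM => //; apply: cconv_cst.
  move=> n; have [Lam sL [lu' lv']] := loc_in_common (lu n) (lv n).
  by exists Lam => //; rewrite -scalerAl mul1r; apply: loc_linear.
- move=> a b /norm_closure_seq[u lu ua] /norm_closure_seq[v lv vb].
  apply: seq_norm_closure (cconvM ua vb) => n.
  have [Lam sL [lu' lv']] := loc_in_common (lu n) (lv n).
  by exists Lam => //; apply: loc_mul.
- move=> a /norm_closure_seq[u lu ua].
  apply: seq_norm_closure (cconv_star ua) => n.
  by have [Lam sL lu'] := lu n; exists Lam => //; apply: loc_star.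
- move=> u a lu ua eps eps0; have eps2 : 0 < eps / 2 by lra.
  have [n un] := cconv_near eps2 ua; have [b lb ub] := lu n _ eps2.
  exists b => //; apply: le_lt_trans (cnorm_dist_trans (u n) _ _) _.
  by rewrite cnorm_distC; lra.
Qed.

Lemma loc_dense a : norm_closure (\bigcup_Lam local_alg Lam) a.
Proof. by have := iota_dense A_lim; rewrite /local_alg => ->. Qed.

Section StateNorm.
Variable phi : A -> R[i].
Hypothesis phi_state : is_state [set: A] phi.

Definition re_state a : R := complex.Re (phi a).

Lemma stateP (k : R[i]) a b : phi (k *: a + b) = k * phi a + phi b.
Proof. exact: (state_linear phi_state). Qed.

Lemma stateD a b : phi (a + b) = phi a + phi b.
Proof. by have := stateP 1 a b; rewrite scale1r mul1r. Qed.

Lemma state0 : phi 0 = 0.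
Proof. by apply: (addrI (phi 0)); rewrite -stateD !addr0. Qed.

Lemma stateZ (k : R[i]) a : phi (k *: a) = k * phi a.
Proof. by have := stateP k a 0; rewrite !addr0 state0 addr0. Qed.

(** That the real part of a state is invariant under the involution follows from
    the values of the state at (1 + i a)^* (1 + i a) being real. *)
Lemma re_state_positive : positive_functional re_state.
Proof.
split.
- by move=> a b; rewrite /re_state stateD; case: (phi a) (phi b) => ? ? [].
- by move=> t a; rewrite /re_state stateZ; case: (phi a) => x y /=; ring.
- move=> a; rewrite /re_state.
  have := state_positive phi_state (b := 1 + 'i%C *: a) I.
  move=> /ger0_Im; rewrite starD star1 starZi mulrDl mul1r mulrDr mulr1.
  have := ger0_Im (state_positive phi_state (b := 1) I).
  have := ger0_Im (state_positive phi_state (b := a) I).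
  rewrite star1 mul1r -scalerAl -scalerAr scalerA mulNr -expr2 sqr_i opprK scale1r.
  rewrite !stateD !stateZ; case: (phi (star a * a)) => x1 y1 /= ->.
  case: (phi 1) => x2 y2 /= ->; case: (phi a) => x3 y3; case: (phi (star a)) => x4 y4 /=.
  by lra.
- move=> a; have := state_positive phi_state (b := a) I.
  by rewrite /re_state lecE => /andP[].
Qed.

Let f_pos := re_state_positive.

Lemma re_state1 : re_state 1 = 1.
Proof. by rewrite /re_state (state_unit phi_state). Qed.

Definition sqmod (z : R[i]) : R := complex.Re z ^+ 2 + complex.Im z ^+ 2.

Lemma cnormZE (k : R[i]) (a : A) : cnorm (k *: a) = Num.sqrt (sqmod k) * cnorm a.
Proof. by apply: complexI; rewrite cnormZ rmorphM /= normc_def. Qed.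

Lemma conj_mul (z : R[i]) : Num.conj z * z = (sqmod z)%:C.
Proof. by rewrite mulrC -normCK add_Re2_Im2. Qed.

(** Test the hypothesis on the matrix unit b = e_j e_w^*, where w is a basis vector
    on which the state does not vanish: both sides become multiples of the value
    of the state at e_w e_w^*, and the j-th column of m appears. *)
Lemma entry_bound Lam (m : bnd R d Lam) s : 
  (forall b, re_state (star (iota m * b) * (iota m * b)) <=
             s ^+ 2 * re_state (star b * b)) ->
  forall i j, sqmod (m i j) <= s ^+ 2.
Proof.
move=> ms i j.
have [w w0] : exists w, 0 < re_state (iota (delta_mx w w : bnd R d Lam)).
  apply: contrapT => hw.
  have : re_state 1 = 0.
    rewrite -(iota1 Lam) mx1_sum_delta iota_sum (pf_sum f_pos).
    rewrite big1 // => w _; apply/eqP/negPn/negP => w0; apply: hw; exists w.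
    rewrite lt_neqAle eq_sym w0.
    have := pf_ge0 f_pos (iota (delta_mx w w : bnd R d Lam)).
    by rewrite -(iota_star A_lim) -iotaM trmx_delta map_delta_mx mul_delta_mx.
  by move=> h; have := @oner_neq0 R; rewrite -re_state1 h eqxx.
have := ms (iota (delta_mx j w)).
rewrite -!iotaM -!(iota_star A_lim) -!iotaM.
rewrite trmx_delta map_delta_mx mul_delta_mx.
have -> : (map_mx Num.conj (m *m delta_mx j w)^T) *m (m *m delta_mx j w) =
   (\sum_l sqmod (m l j))%:C *: delta_mx w w.
  have E l p : (m *m delta_mx j w) l p = m l j * (p == w)%:R.
    rewrite mxE (bigD1 j) //= big1 ?addr0 => [|k kj]; first by rewrite mxE eqxx.
    by rewrite mxE (negPf kj) mulr0.
  apply/matrixP => p q; rewrite mxE [RHS]mxE mxE rmorph_sum mulr_suml.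
  apply: eq_bigr => l _; rewrite mxE [_^T _ _]mxE !E rmorphM rmorph_nat /= -conj_mul.
  by case: (p == w); case: (q == w); rewrite ?mulr1 ?mulr0 ?mul0r.
rewrite iotaZ (pfZ f_pos) ler_pM2r //; apply: le_trans.
rewrite (bigD1 i) //= lerDl sumr_ge0 // => l _.
by rewrite addr_ge0 ?sqr_ge0.
Qed.

Lemma loc_norm_bound Lam : exists K, forall (m : bnd R d Lam) s, 0 <= s ->
  (forall b, re_state (star (iota m * b) * (iota m * b)) <=
             s ^+ 2 * re_state (star b * b)) ->
  cnorm (iota m) <= K * s.
Proof.
exists (\sum_i \sum_j cnorm (iota (delta_mx i j : bnd R d Lam))) => m s s0 ms.
rewrite [m]matrix_sum_delta iota_sum mulr_suml.
apply: le_trans (cnorm_sum_le _ _ _) (ler_sum _ _) => i _.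
rewrite iota_sum mulr_suml.
apply: le_trans (cnorm_sum_le _ _ _) (ler_sum _ _) => j _.
rewrite iotaZ cnormZE mulrC ler_wpM2l ?cnorm_ge0 //.
by have := ler_wsqrtr (entry_bound ms i j); rewrite sqrtr_sqr ger0_norm.
Qed.

(** A bound that is lossy by a constant factor, applied to the powers of a^* a,
    yields the exact one: the C*-norm is multiplicative on them. *)
Lemma loc_state_norm Lam (m : bnd R d Lam) r : 0 < r ->
  (forall b, re_state (star (iota m * b) * (iota m * b)) <=
             r ^+ 2 * re_state (star b * b)) ->
  cnorm (iota m) <= r.
Proof.
move=> r0 mr; set a := iota m.
have [K KP] := loc_norm_bound Lam.
pose fix h k : bnd R d Lam :=
  if k is k'.+1 then h k' *m h k' else map_mx Num.conj m^T *m m.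
have h_herm k : star (iota (h k)) = iota (h k).
  elim: k => [|k IH] /=; first by rewrite iotaM (iota_star A_lim) starM starK.
  by rewrite iotaM starM IH.
have h_norm k : cnorm (iota (h k)) = cnorm a ^+ (2 ^ k.+1).
  elim: k => [|k IH] /=; first by rewrite iotaM (iota_star A_lim) cnorm_starM.
  by rewrite iotaM -{1}h_herm cnorm_starM IH -exprM -expnSr.
have h_bound k b : re_state (star (iota (h k) * b) * (iota (h k) * b)) <=
    (r ^+ (2 ^ k.+1)) ^+ 2 * re_state (star b * b).
  apply: (opbound_scalar_le f_pos).
  elim: k => [|k IH] /=.
    have ma : opbound re_state (a%:M : 'M_1) r.
      by apply: (opbound_scalar f_pos); rewrite ?ltW.
    rewrite iotaM (iota_star A_lim) scalar_mxM -/a expr2; apply: opboundM => //.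
    by rewrite -adj_scalar; apply: (opbound_adj f_pos).
  by rewrite iotaM scalar_mxM expnSr exprM expr2; apply: opboundM.
have bound k : cnorm a ^+ (2 ^ k.+1) <= K * r ^+ (2 ^ k.+1).
  by rewrite -h_norm; apply: KP => //; apply: exprn_ge0; apply: ltW.
rewrite leNgt; apply/negP => ra.
pose x := cnorm a / r; have x1 : 0 < x - 1 by rewrite subr_gt0 ltr_pdivlMr ?mul1r.
have xK N : x ^+ (2 ^ N.+1) <= K.
  by rewrite expr_div_n ler_pdivrMr ?exprn_gt0.
have bernoulli N : N%:R * (x - 1) <= x ^+ N.
  elim: N => [|N IH]; first by rewrite mul0r.
  have x1N : 1 <= x ^+ N by apply: exprn_ege1; lra.
  by rewrite exprS -natr1; nra.
have := archi_boundP (x := K / (x - 1)); set N := Num.bound _.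
rewrite ltr_pdivrMr // => NK; have K0 : 0 <= K.
  by apply: le_trans (xK 0); apply: exprn_ge0; lra.
have := NK (divr_ge0 K0 (ltW x1)); have := bernoulli (2 ^ N.+1)%N; have := xK N.
have : (N%:R : R) <= (2 ^ N.+1)%:R.
  by rewrite ler_nat (leq_trans (leqnSn N)) // ltnW // ltn_expl.
by nra.
Qed.


(** The representation defined by the state is isometric.  On local elements this is
    [loc_state_norm]; the general case follows by density, as a small norm implies
    a small operator norm. *)
Lemma state_norm a r : 0 <= r ->
  (forall b, re_state (star (a * b) * (a * b)) <= r ^+ 2 * re_state (star b * b)) ->
  cnorm a <= r.
Proof.
move=> r0 ar; apply/ler_addgt0Pr => eps eps0.
have eps3 : 0 < eps / 3 by lra.
have [c [Lam _ [m _ mc]] ac] := loc_dense a eps3.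
have cr : cnorm c <= r + eps / 3.
  rewrite -mc; apply: loc_state_norm => [|b]; first lra.
  apply: (opbound_scalar_le f_pos).
  rewrite mc (_ : (c%:M : 'M_1) = a%:M + (c - a)%:M); last first.
    by rewrite -raddfD /= addrC subrK.
  apply: (opboundD f_pos) => //; first exact: (opbound_scalar f_pos).
  apply: (opbound_scalar f_pos) => [|b']; first lra.
  by apply: (positive_functional_bound f_pos); rewrite // cnorm_distC ltW.
by have := cnorm_dist_trans c a 0; rewrite !subr0; lra.
Qed.

End StateNorm.
End InductiveLimit.

(** * Local algebras and partial expectations *)

Section Kernels.
Variables (R : realType) (L : countType) (d : nat).
Implicit Types Lam Gam Del : {fset L}.

(** Entries of local operators, indexed by configurations and not by their ranks. *)
Definition ent Lam (m : bnd R d Lam) (w w' : config d Lam) : R[i] :=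
  m (enum_rank w) (enum_rank w').

Lemma ent_inj Lam (m m' : bnd R d Lam) :
  (forall w w', ent m w w' = ent m' w w') -> m = m'.
Proof.
move=> E; apply/matrixP => i j; have := E (enum_val i) (enum_val j).
by rewrite /ent !enum_valK.
Qed.

Lemma ent_mul Lam (m m' : bnd R d Lam) w w' :
  ent (m *m m') w w' = \sum_u ent m w u * ent m' u w'.
Proof.
rewrite /ent mxE (reindex (@enum_rank (config d Lam))) //=.
by exists enum_val => i _; rewrite ?enum_rankK ?enum_valK.
Qed.

Lemma ent_tensor1 Lam Gam (s : (Lam `<=` Gam)%fset) (a : bnd R d Lam) w w' :
  ent (tensor1 s a) w w' =
  if [forall x : Gam, (val x \notin Lam) ==> (w x == w' x)]
  then ent a (restrict_config s w) (restrict_config s w') else 0.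
Proof. by rewrite /ent mxE !enum_rankK. Qed.

(** Kernels multiply over complementary regions.  This is how the tensor product
    structure enters: commutation of disjoint regions, the factorization of matrix
    units and that of the mean projections are all read off from it. *)
Lemma ent_tensor1_mul Lam Lam' Gam (s : (Lam `<=` Gam)%fset) (s' : (Lam' `<=` Gam)%fset)
    (a : bnd R d Lam) (b : bnd R d Lam') w w' :
  (forall x, x \in Lam -> x \notin Lam') ->
  (forall x, x \in Gam -> x \notin Lam -> x \in Lam') ->
  ent (tensor1 s a *m tensor1 s' b) w w' =
  ent a (restrict_config s w) (restrict_config s w') *
  ent b (restrict_config s' w) (restrict_config s' w').
Proof.
move=> dis cov; rewrite ent_mul.
(* the only intermediate configuration that contributes *)
pose u : config d Gam := [ffun x => if val x \in Lam then w' x else w x].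
rewrite (bigD1 u) //= [X in _ + X]big1 ?addr0 => [|v /eqP vu].
  rewrite !ent_tensor1 !ifT.
  - congr (_ * _); congr ent; apply/ffunP => x; rewrite !ffunE /=.
    + by rewrite (valP x).
    + by rewrite ifN //; apply/negP => /dis/negP; apply; exact: valP.
  - apply/forallP => x; apply/implyP => nx; rewrite ffunE ifT //.
    by apply/negPn/negP => /(cov _ (valP x)); apply/negP.
  - by apply/forallP => x; apply/implyP => nx; rewrite ffunE (negPf nx).
rewrite !ent_tensor1; case: forallP => [wv|_]; last by rewrite mul0r.
case: forallP => [vw|_]; last by rewrite mulr0.
case: vu; apply/ffunP => x; rewrite ffunE; case: ifPn => nx.
  by apply/esym/eqP; have := vw x; rewrite (dis _ nx) eq_sym.
by apply/esym/eqP; have := wv x; rewrite nx.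
Qed.

End Kernels.

Section Local.
Variables (R : realType) (L : countType) (d : nat).
Variables (A : cstarAlgType R) (iota : forall Lam : {fset L}, bnd R d Lam -> A).
Hypothesis A_lim : is_inductive_limit iota.
Implicit Types Lam Gam Del : {fset L}.

Lemma loc_comm Lam Lam' a b : (forall x, x \in Lam -> x \notin Lam') ->
  local_alg iota Lam a -> local_alg iota Lam' b -> a * b = b * a.
Proof.
move=> dis [m _ <-] [m' _ <-].
have s := fsubsetUl Lam Lam'; have s' := fsubsetUr Lam Lam'.
rewrite -(iota_tensor1 A_lim s) -(iota_tensor1 A_lim s') -!(iotaM A_lim).
congr iota; apply: ent_inj => w w'; rewrite !ent_tensor1_mul 1?mulrC //.
- by move=> x xL'; apply/negP => /dis; rewrite xL'.
- by move=> x; rewrite inE => /orP[//|->] /negP.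
- by move=> x; rewrite inE => /orP[->|].
Qed.

Lemma subalg_comm Lam (I : set L) c x : (forall y, y \in Lam -> ~ I y) ->
  subalg iota I c -> local_alg iota Lam x -> c * x = x * c.
Proof.
move=> dis /norm_closure_seq[u lu uc] lx.
have := cconvM uc (cconv_cst x); have := cconvM (cconv_cst x) uc.
rewrite (_ : (fun n => x * u n) = fun n => u n * x).
  by move=> xc cx; apply: cconv_unique cx xc.
apply: funext => n; have [Gam sG lG] := lu n; apply: loc_comm lx lG => y yL.
by apply/negP => yG; apply: dis yL (sG _ yG).
Qed.

Local Notation N Lam := (hdim d Lam).

Lemma hdimD Lam Gam : (Lam `<=` Gam)%fset -> N Gam = (N (Gam `\` Lam)%fset * N Lam)%N.
Proof.
move=> s; rewrite /hdim !card_ffun card_ord -!cardfE -expnD; congr (_ ^ _)%N.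
by rewrite cardfsD (fsetIidPr s) subnK // fsubset_leq_card.
Qed.

(** The rank one projection onto the product vector whose coordinates are all
    equal. *)
Definition mean_mx Lam : bnd R d Lam := const_mx (N Lam)%:R^-1.
Definition mean_proj Lam : A := iota (mean_mx Lam).

Hypothesis d_gt0 : (0 < d)%N.

Lemma hdim_gt0 Lam : (0 < N Lam)%N.
Proof. by rewrite /hdim card_ffun card_ord expn_gt0 d_gt0. Qed.

Lemma hdim_neq0 Lam : (N Lam)%:R != 0 :> R[i].
Proof. by rewrite pnatr_eq0 -lt0n hdim_gt0. Qed.

Lemma mean_proj_idem Lam : mean_proj Lam * mean_proj Lam = mean_proj Lam.
Proof.
rewrite /mean_proj -(iotaM A_lim); congr iota; apply/matrixP => i j; rewrite !mxE.
under eq_bigr do rewrite !mxE.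
by rewrite sumr_const card_ord -[LHS]mulr_natl mulrA divff ?mul1r // hdim_neq0.
Qed.

Lemma loc_mean Lam : local_alg iota Lam (mean_proj Lam).
Proof. by exists (mean_mx Lam). Qed.

Lemma mean_proj_sub Lam Gam : (Lam `<=` Gam)%fset ->
  mean_proj Gam * mean_proj Lam = mean_proj Gam /\
  mean_proj Lam * mean_proj Gam = mean_proj Gam.
Proof.
move=> s; have s' := fsubsetDl Gam Lam.
have dis x : x \in (Gam `\` Lam)%fset -> x \notin Lam by rewrite inE => /andP[].
have E : mean_proj Gam = mean_proj (Gam `\` Lam)%fset * mean_proj Lam.
  rewrite /mean_proj -(iota_tensor1 A_lim s) -(iota_tensor1 A_lim s') -(iotaM A_lim).
  congr iota; apply: ent_inj => w w'; rewrite ent_tensor1_mul //.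
    by rewrite /ent !mxE (hdimD s) natrM invfM.
  by move=> x xG; rewrite inE xG andbT negbK.
have C := loc_comm dis (loc_mean _) (loc_mean _).
rewrite E; split; first by rewrite -mulrA mean_proj_idem.
by rewrite C mulrA mean_proj_idem.
Qed.

Definition kraus_mx Lam (k : 'I_(N Lam)) : bnd R d Lam :=
  \matrix_(i, j) if j == k then (Num.sqrt (N Lam)%:R^-1)%:C else 0.
Definition kraus Lam (k : 'I_(N Lam)) : A := iota (kraus_mx k).

(** The partial expectation of Lam in the product vector state h with all
    coordinates equal; in this Kraus form, with operators h e_k^*, it makes sense
    on all of A. *)
Definition slice Lam (a : A) : A := \sum_k star (@kraus Lam k) * a * kraus k.

Lemma loc_kraus Lam (k : 'I_(N Lam)) : local_alg iota Lam (kraus k).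
Proof. by exists (kraus_mx k). Qed.


Let norm2 Lam : (Num.sqrt (N Lam)%:R^-1)%:C * (Num.sqrt (N Lam)%:R^-1)%:C =
  (N Lam)%:R^-1 :> R[i].
Proof.
rewrite -rmorphM -expr2 sqr_sqrtr ?invr_ge0 ?ler0n //=.
by rewrite fmorphV rmorph_nat.
Qed.

Let star_iota Lam (m : bnd R d Lam) : star (iota m) = iota (map_mx Num.conj m^T).
Proof. by rewrite (iota_star A_lim). Qed.

Let conj_norm Lam : Num.conj (Num.sqrt (N Lam)%:R^-1)%:C =
  (Num.sqrt (N Lam)%:R^-1)%:C :> R[i].
Proof. exact: conjc_real. Qed.

Lemma sliceP Lam (k : R[i]) a b :
  slice Lam (k *: a + b) = k *: slice Lam a + slice Lam b.
Proof.
rewrite /slice scaler_sumr -big_split; apply: eq_bigr => i _ /=.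
by rewrite mulrDr mulrDl -scalerAr -scalerAl.
Qed.

Lemma kraus_sandwich Lam (m : bnd R d Lam) (k : 'I_(N Lam)) :
  star (kraus k) * iota m * kraus k =
  ((N Lam)%:R^-1 * \sum_i \sum_j m i j) *: iota (delta_mx k k).
Proof.
rewrite star_iota -!(iotaM A_lim) -(iotaZ A_lim); congr iota.
have starE i q : map_mx Num.conj (kraus_mx k)^T i q =
    if i == k then (Num.sqrt (N Lam)%:R^-1)%:C else 0.
  by rewrite !mxE; case: eqP => _; rewrite ?rmorph0 ?conj_norm.
apply/matrixP => i j; rewrite mxE [RHS]mxE [delta_mx _ _ _ _]mxE.
have [jk|jk] := eqVneq j k; last first.
  by rewrite andbF mulr0 big1 // => l _; rewrite [kraus_mx _ _ _]mxE (negPf jk) mulr0.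
have [ik|ik] := eqVneq i k; last first.
  rewrite mulr0 big1 // => l _; rewrite mxE big1 ?mul0r // => p _.
  by rewrite starE (negPf ik) mul0r.
rewrite mulr1 -norm2 exchange_big !mulr_sumr; apply: eq_bigr => l _.
rewrite mxE [kraus_mx _ _ _]mxE jk eqxx mulr_suml mulr_sumr.
by apply: eq_bigr => p _; rewrite starE ik eqxx mulrAC.
Qed.

Lemma slice_loc_scalar Lam a : local_alg iota Lam a ->
  exists c : R[i], slice Lam a = c%:A.
Proof.
move=> [m _ <-]; exists ((N Lam)%:R^-1 * \sum_i \sum_j m i j).
rewrite /slice -(iota1 A_lim Lam) mx1_sum_delta (iota_sum A_lim) scaler_sumr.
by apply: eq_bigr => k _; rewrite kraus_sandwich.
Qed.

Lemma slice1 Lam : slice Lam 1 = 1.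
Proof.
rewrite /slice -[RHS](iota1 A_lim Lam) [in RHS]mx1_sum_delta (iota_sum A_lim).
apply: eq_bigr => k _; rewrite -(iota1 A_lim Lam) kraus_sandwich.
rewrite -[RHS]scale1r; congr (_ *: _).
under eq_bigr => i _.
  rewrite (bigD1 i) //= mxE eqxx big1 ?addr0 => [|j ji].
    over.
  by rewrite mxE eq_sym (negPf ji).
by rewrite sumr_const card_ord mulVf // hdim_neq0.
Qed.

(** As h e_k^* h is a multiple of h independent of k, the mean projection absorbs the
    Kraus operators. *)
Lemma slice_compress Lam a :
  mean_proj Lam * slice Lam a * mean_proj Lam = mean_proj Lam * a * mean_proj Lam.
Proof.
have Kp (k : 'I_(N Lam)) :
    kraus k * mean_proj Lam = (Num.sqrt (N Lam)%:R^-1)%:C *: mean_proj Lam.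
  rewrite /kraus /mean_proj -(iotaM A_lim) -(iotaZ A_lim); congr iota.
  apply/matrixP => i j; rewrite !mxE (bigD1 k) //= !mxE eqxx big1 ?addr0 // => l lk.
  by rewrite !mxE (negPf lk) mul0r.
have Ps : star (mean_proj Lam) = mean_proj Lam.
  rewrite star_iota; congr iota; apply/matrixP => i j; rewrite !mxE.
  by rewrite fmorphV rmorph_nat.
have pK (k : 'I_(N Lam)) :
    mean_proj Lam * star (kraus k) = (Num.sqrt (N Lam)%:R^-1)%:C *: mean_proj Lam.
  by rewrite -[in LHS]Ps -starM Kp starZR Ps.
rewrite /slice mulr_sumr mulr_suml.
under eq_bigr => k _.
  rewrite -!mulrA Kp !mulrA pK -!scalerAr -!scalerAl scalerA norm2; over.
rewrite sumr_const card_ord -scaler_nat scalerA divff ?scale1r //.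
exact: hdim_neq0.
Qed.

End Local.

Section Slices.
Variables (R : realType) (L : countType) (d : nat).
Variables (A : cstarAlgType R) (iota : forall Lam : {fset L}, bnd R d Lam -> A).
Hypothesis A_lim : is_inductive_limit iota.
Implicit Types Lam Gam Del : {fset L}.

Lemma restrict_config_inj Lam Lam' Gam (s : (Lam `<=` Gam)%fset)
    (s' : (Lam' `<=` Gam)%fset) (w v : config d Gam) :
  (forall x, x \in Gam -> x \notin Lam -> x \in Lam') ->
  (w == v) = (restrict_config s w == restrict_config s v) &&
             (restrict_config s' w == restrict_config s' v).
Proof.
move=> cov; apply/eqP/andP => [->|[/eqP/ffunP E /eqP/ffunP E']]; first by rewrite !eqxx.
apply/ffunP => x; have [xL|xL] := boolP (val x \in Lam).
  have := E [` xL]%fset; rewrite !ffunE (_ : fincl s _ = x) //; exact: val_inj.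
have xL' := cov _ (valP x) xL.
have := E' [` xL']%fset; rewrite !ffunE (_ : fincl s' _ = x) //; exact: val_inj.
Qed.

Lemma tensor1_delta_mul Lam Lam' Gam (s : (Lam `<=` Gam)%fset) (s' : (Lam' `<=` Gam)%fset)
    (v v' : config d Gam) :
  (forall x, x \in Lam -> x \notin Lam') ->
  (forall x, x \in Gam -> x \notin Lam -> x \in Lam') ->
  delta_mx (enum_rank v) (enum_rank v') =
  tensor1 s (delta_mx (enum_rank (restrict_config s v)) (enum_rank (restrict_config s v'))) *m
  tensor1 s' (delta_mx (enum_rank (restrict_config s' v)) (enum_rank (restrict_config s' v')))
  :> bnd R d Gam.
Proof.
move=> dis cov; apply: ent_inj => w w'; rewrite ent_tensor1_mul // /ent !mxE.
rewrite !(inj_eq enum_rank_inj) !(restrict_config_inj s s' _ _ cov) -natrM mulnb.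
by rewrite andbACA.
Qed.

Lemma slice_mul_comm Lam c a : (forall x, local_alg iota Lam x -> c * x = x * c) ->
  slice iota Lam (c * a) = c * slice iota Lam a.
Proof.
move=> cC; rewrite /slice mulr_sumr; apply: eq_bigr => k _.
by rewrite !mulrA -cC //; apply/(loc_star A_lim)/loc_kraus.
Qed.

Hypothesis d_gt0 : (0 < d)%N.

(** Matrix units of Gam are products of matrix units of the complement of Lam, which
    the partial expectation leaves alone, and of matrix units of Lam, which it maps
    to scalars. *)
Lemma slice_loc Lam Gam a : (Lam `<=` Gam)%fset -> local_alg iota Gam a ->
  local_alg iota (Gam `\` Lam)%fset (slice iota Lam a).
Proof.
move=> s [m _ <-]; have s' := fsubsetDl Gam Lam.
have dis x : x \in (Gam `\` Lam)%fset -> x \notin Lam by rewrite inE => /andP[].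
have sliceD b c : slice iota Lam (b + c) = slice iota Lam b + slice iota Lam c.
  by have := sliceP iota Lam 1 b c; rewrite !scale1r.
have slice0 : slice iota Lam 0 = 0.
  by apply: (addrI (slice iota Lam 0)); rewrite -sliceD !addr0.
rewrite [m]matrix_sum_delta (iota_sum A_lim) (big_morph _ sliceD slice0).
apply: (loc_sum A_lim) => i _; rewrite (iota_sum A_lim) (big_morph _ sliceD slice0).
apply: (loc_sum A_lim) => j _; rewrite (iotaZ A_lim).
have sliceZ (x : R[i]) b : slice iota Lam (x *: b) = x *: slice iota Lam b.
  by have := sliceP iota Lam x b 0; rewrite slice0 !addr0.
rewrite sliceZ -(enum_valK i) -(enum_valK j) (tensor1_delta_mul s' s) //; last first.
  by move=> x xG; rewrite inE xG andbT negbK.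
rewrite (iotaM A_lim) !(iota_tensor1 A_lim) slice_mul_comm => [|x lx].
  set b := iota (delta_mx (enum_rank (restrict_config s _)) _).
  have [c ->] : exists c : R[i], slice iota Lam b = c%:A.
    by apply: (slice_loc_scalar A_lim); eexists.
  rewrite -scalerAr mulr1 scalerA -[X in local_alg _ _ X]addr0.
  apply: (loc_linear A_lim); first by eexists.
  by exists 0; rewrite // (iota0 A_lim).
by apply: (loc_comm A_lim dis) => //; eexists.
Qed.

Lemma slice_outside Lam a : subalg iota (~` [set` Lam]) (slice iota Lam a).
Proof.
have [u lu ua] := norm_closure_seq (loc_dense A_lim a).
have su : cconv (fun n => slice iota Lam (u n)) (slice iota Lam a).
  apply: cconv_sum => k _; apply: cconvM (cconv_cst _).
  by apply: cconvM => //; exact: cconv_cst.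
apply: seq_norm_closure su => n; have [Gam _ lG] := lu n.
exists ((Gam `|` Lam) `\` Lam)%fset; first by move=> x /=; rewrite inE => /andP[/negP].
apply: slice_loc; first exact: fsubsetUr.
by apply: (loc_mono A_lim) lG; exact: fsubsetUl.
Qed.

End Slices.

(** * Diagonal operators *)

Section Diagonal.
Variables (R : realType) (L : countType) (d : nat).
Variables (A : cstarAlgType R) (iota : forall Lam : {fset L}, bnd R d Lam -> A).
Hypothesis A_lim : is_inductive_limit iota.
Implicit Types Lam Gam Del : {fset L}.

Definition diag_op Lam (g : config d Lam -> R[i]) : bnd R d Lam :=
  diag_mx (\row_j g (enum_val j)).

Lemma ent_diag_op Lam (g : config d Lam -> R[i]) w w' :
  ent (diag_op g) w w' = g w *+ (w == w').
Proof. by rewrite /ent !mxE enum_rankK (inj_eq enum_rank_inj). Qed.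

Lemma ent_diag_mul Lam (g : config d Lam -> R[i]) m w w' :
  ent (diag_op g *m m) w w' = g w * ent m w w'.
Proof. by rewrite /ent mul_diag_mx !mxE enum_rankK. Qed.

Lemma ent_mul_diag Lam (g : config d Lam -> R[i]) m w w' :
  ent (m *m diag_op g) w w' = ent m w w' * g w'.
Proof. by rewrite /ent mul_mx_diag !mxE enum_rankK. Qed.

Lemma diag_opM Lam (g h : config d Lam -> R[i]) :
  diag_op g *m diag_op h = diag_op (fun w => g w * h w).
Proof.
by rewrite /diag_op mulmx_diag; congr diag_mx; apply/rowP => j; rewrite !mxE.
Qed.

Lemma iota_diag_star Lam (g : config d Lam -> R[i]) :
  star (iota (diag_op g)) = iota (diag_op (fun w => Num.conj (g w))).
Proof.
rewrite -(iota_star A_lim) /diag_op tr_diag_mx map_diag_mx; congr iota.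
by congr diag_mx; apply/rowP => j; rewrite !mxE.
Qed.

Lemma iota_diag_widen Lam Gam (s : (Lam `<=` Gam)%fset) (g : config d Lam -> R[i]) :
  iota (diag_op g) = iota (diag_op (fun w => g (restrict_config s w))).
Proof.
rewrite -(iota_tensor1 A_lim s); congr iota; apply: ent_inj => w w'.
rewrite ent_tensor1 !ent_diag_op.
have [<-|ww'] := eqVneq w w'.
  by rewrite eqxx ifT //; apply/forallP => x; rewrite eqxx implybT.
case: forallP => // E; rewrite mulr0n; case: eqP => // Er; case/eqP: ww'.
apply/ffunP => x; have [xL|xL] := boolP (val x \in Lam); last first.
  by apply/eqP; have := E x; rewrite xL.
have /ffunP/(_ [` xL]%fset) := Er; rewrite !ffunE (_ : fincl s _ = x) //.
exact: val_inj.
Qed.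

(** The kernel of an operator on Lam vanishes between configurations that differ
    outside Lam, and g does not distinguish the others. *)
Lemma iota_diag_comm Lam Gam (g : config d Gam -> R[i]) a : (Lam `<=` Gam)%fset ->
  (forall w w' : config d Gam,
     (forall x : Gam, val x \notin Lam -> w x = w' x) -> g w = g w') ->
  local_alg iota Lam a -> iota (diag_op g) * a = a * iota (diag_op g).
Proof.
move=> s gE [m _ <-]; rewrite -(iota_tensor1 A_lim s) -!(iotaM A_lim); congr iota.
apply: ent_inj => w w'; rewrite ent_diag_mul ent_mul_diag.
rewrite ent_tensor1; case: forallP => [E|_]; last by rewrite mulr0 mul0r.
rewrite mulrC; congr (_ * _); apply: gE => x xL; apply/eqP.
by have := E x; rewrite xL.
Qed.

End Diagonal.

(** * Balls of the tree *)

Section Balls.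
Variables (L : countType) (e : rel L).
Hypothesis e_tree : is_tree e.
Variable x0 : L.

Lemma finite_gclosure (Lam : {fset L}) : finite_set (gclosure e Lam).
Proof.
rewrite finite_setU; split; first exact: finite_fset.
apply: (@sub_finite_set _ _ (\bigcup_(y in [set` Lam]) [set x | e y x])).
  by move=> x [_ [y yL xy]]; exists y; rewrite //= (tree_sym e_tree).
apply: bigcup_finite; first exact: finite_fset.
by move=> y _; exact: (tree_locally_finite e_tree).
Qed.

(** The empty region has an empty closure, so the iteration starts at a point. *)
Definition tree_ball n : {fset L} :=
  if n is k.+1 then iter k (fun Lam => fset_set (gclosure e Lam)) [fset x0]%fset
  else fset0.

Lemma tree_ballS n : gclosure e (tree_ball n) `<=` [set` tree_ball n.+1].
Proof.
case: n => [x [//|[_ []//]]|n x].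
by rewrite /= in_fset_set ?inE //; exact: finite_gclosure.
Qed.

Lemma tree_ball_gclosure n : [set` tree_ball n.+2] `<=` gclosure e (tree_ball n.+1).
Proof. by move=> x /=; rewrite in_fset_set ?inE //; exact: finite_gclosure. Qed.

Lemma tree_ball_edge n x y : e x y -> x \in tree_ball n -> y \in tree_ball n.+1.
Proof.
move=> xy xn; apply: tree_ballS; have [yn|yn] := boolP (y \in tree_ball n); [by left|right].
by split=> //; exists x; rewrite // (tree_sym e_tree).
Qed.

Lemma tree_ball_subS n : (tree_ball n `<=` tree_ball n.+1)%fset.
Proof. by apply/fsubsetP => x xn; apply: tree_ballS; left. Qed.

Lemma tree_ball_sub n m : (n <= m)%N -> (tree_ball n `<=` tree_ball m)%fset.
Proof.
move=> /subnKC <-; elim: (m - n)%N => [|k IH]; first by rewrite addn0.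
by rewrite addnS; apply: fsubset_trans IH (tree_ball_subS _).
Qed.

Lemma tree_ball_cover x : exists n, x \in tree_ball n.
Proof.
have [p [xp _ <-]] := tree_connected e_tree (isT : x0 \in predT) (isT : x \in predT).
have : x0 \in tree_ball 1 by rewrite inE.
elim: p x0 (1%N) xp => [y n _ yn|z p IH y n /= /andP[yz zp] yn]; first by exists n.
exact: IH zp (tree_ball_edge yz yn).
Qed.

Lemma tree_ball_exhaust (Lam : {fset L}) : exists n, (Lam `<=` tree_ball n)%fset.
Proof.
suff [n nP] : exists n, forall x, x \in (enum_fset Lam) -> x \in tree_ball n.
  by exists n; apply/fsubsetP.
elim: (enum_fset Lam) => [|x s [n nP]]; first by exists 0%N.
have [m xm] := tree_ball_cover x; exists (maxn n m) => y; rewrite inE => /orP[/eqP ->|/nP].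
  exact: (fsubsetP (tree_ball_sub (leq_maxr n m))).
exact: (fsubsetP (tree_ball_sub (leq_maxl n m))).
Qed.

Lemma tree_ball_connected n : connected_in e (mem (tree_ball n)).
Proof.
suff H x : x \in tree_ball n ->
    (exists p, [/\ path e x0 p, all (mem (tree_ball n)) p & last x0 p = x]) /\
    (exists p, [/\ path e x p, all (mem (tree_ball n)) p & last x p = x0]).
  move=> x y /H[_ [p [xp pn px]]] /H[[q [yq qn qy]] _].
  exists (p ++ q); split; first by rewrite cat_path xp px.
    by rewrite all_cat pn qn.
  by rewrite last_cat px.
case: n => [//|n]; elim: n x => [|n IH] x.
  by rewrite !inE => /eqP ->; split; exists [::].
have sub := fsubsetP (tree_ball_subS n.+1).
have x0n : x0 \in tree_ball n.+2.
  by apply: (fsubsetP (tree_ball_sub _ : (tree_ball 1 `<=` _)%fset)); rewrite ?inE.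
have sub_all p : all (mem (tree_ball n.+1)) p -> all (mem (tree_ball n.+2)) p.
  by apply: sub_all => y /=; exact: sub.
move=> xn2; have [xn|] := boolP (x \in tree_ball n.+1).
  have [[p [? /sub_all ? ?]] [q [? /sub_all ? ?]]] := IH x xn.
  by split; [exists p|exists q].
have [|[_ [y yn xy]] xn] := tree_ball_gclosure xn2; first by move=> /= ->.
have yx : e y x by rewrite (tree_sym e_tree).
have [[p [px /sub_all pn py]] [q [qx /sub_all qn qy]]] := IH y yn.
split; [exists (rcons p x)|exists (y :: q)].
  by rewrite rcons_path py px yx last_rcons all_rcons /= xn2 pn.
by rewrite /= xy qx (sub _ yn) qn.
Qed.

End Balls.

(** * The phases of the amplitudes *)

Section Phases.
Variables (R : realType) (L : countType) (e : rel L) (d : nat).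
Variables (A : cstarAlgType R) (iota : forall Lam : {fset L}, bnd R d Lam -> A).
Variable psi : L -> L -> 'M[R[i]]_d.
Hypothesis d_gt0 : (0 < d)%N.
Hypothesis A_lim : is_inductive_limit iota.
Hypothesis e_tree : is_tree e.
Hypothesis psi_flat : forall x y i j, e x y -> `|psi x y i j| ^+ 2 = d%:R^-1.
Implicit Types Lam Gam Del : {fset L}.

Definition oriented (x y : L) := e x y && (choice.pickle x < choice.pickle y)%N.

(** Amplitudes of modulus d^(-1/2), rescaled to phases. *)
Definition phase_at (x y : L) (i j : 'I_d) : R[i] :=
  (Num.sqrt d%:R)%:C * psi x y i j.

Definition phase Lam (w : config d Lam) : R[i] :=
  \prod_(p : Lam * Lam | oriented (val p.1) (val p.2))
    phase_at (val p.1) (val p.2) (w p.1) (w p.2).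

Lemma phase_at_unit x y i j : e x y -> Num.conj (phase_at x y i j) * phase_at x y i j = 1.
Proof.
move=> xy; rewrite mulrC -normCK /phase_at normrM exprMn psi_flat //.
rewrite normc_def /= expr0n addr0 sqrtr_sqr ger0_norm ?sqrtr_ge0 //.
by rewrite -rmorphXn /= sqr_sqrtr ?ler0n // rmorph_nat divff ?pnatr_eq0 -?lt0n.
Qed.

Lemma phase_unit Lam (w : config d Lam) : Num.conj (phase w) * phase w = 1.
Proof.
rewrite /phase rmorph_prod -big_split big1 //= => p /andP[xy _].
exact: phase_at_unit.
Qed.

Lemma phase_psi Lam : exists2 c : R[i], c != 0 &
  forall j, phase (enum_val j : config d Lam) = c * psi_vec e psi Lam j 0.
Proof.
exists (\prod_(p : Lam * Lam | oriented (val p.1) (val p.2)) (Num.sqrt d%:R)%:C).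
  apply/prodf_neq0 => p _; rewrite eq_complex /= eqxx andbT gt_eqF //.
  by rewrite sqrtr_gt0 ltr0n.
by move=> j; rewrite mxE -big_split.
Qed.

(** The factors of the phase of Gam that belong to the edges outside Lam. *)
Definition phase_out Lam Gam (w : config d Gam) : R[i] :=
  \prod_(p : Gam * Gam | oriented (val p.1) (val p.2) &&
                         ~~ ((val p.1 \in Lam) && (val p.2 \in Lam)))
    phase_at (val p.1) (val p.2) (w p.1) (w p.2).

(** Reindex the edges with both ends in Lam by pairs of elements of Lam. *)
Lemma phase_split Lam Gam (s : (Lam `<=` Gam)%fset) (w : config d Gam) :
  phase w = phase (restrict_config s w) * phase_out Lam w.
Proof.
rewrite /phase (bigID (fun p : Gam * Gam => (val p.1 \in Lam) && (val p.2 \in Lam))) /=.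
congr (_ * _).
rewrite [LHS](reindex_omap
  (fun p : Lam * Lam => (fincl s p.1, fincl s p.2))
  (fun p : Gam * Gam => if insub (val p.1) is Some x then
     if insub (val p.2) is Some y then Some (x, y) else None else None)) /=; last first.
  move=> [x y] /= /andP[_ /andP[xL yL]]; rewrite !insubT /=.
  by congr (Some (_, _)); apply: val_inj.
apply: eq_big => [[x y]|[x y] _] /=; last by rewrite !ffunE.
rewrite (valP x) (valP y) andbT /=. by rewrite !valK eqxx !andbT.
Qed.

Definition phase_op Lam : A := iota (diag_op (@phase Lam)).

Lemma loc_phase_op Lam : local_alg iota Lam (phase_op Lam).
Proof. by eexists. Qed.

Let diag1 Lam (g : config d Lam -> R[i]) : (forall w, g w = 1) -> iota (diag_op g) = 1.
Proof.
move=> g1; rewrite -(iota1 A_lim Lam); congr iota; apply/matrixP => i j.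
by rewrite !mxE g1.
Qed.

Lemma phase_opVl Lam : star (phase_op Lam) * phase_op Lam = 1.
Proof.
by rewrite (iota_diag_star A_lim) -(iotaM A_lim) diag_opM diag1 // => w; exact: phase_unit.
Qed.

Lemma phase_opVr Lam : phase_op Lam * star (phase_op Lam) = 1.
Proof.
rewrite (iota_diag_star A_lim) -(iotaM A_lim) diag_opM diag1 // => w.
by rewrite mulrC phase_unit.
Qed.

(** The ratio of the phases of Gam and Lam is the product over the edges of Gam
    that are not in Lam.  Such edges do not meet Del, as those that do lie in Lam. *)
Lemma phase_ratio_comm Del Lam Gam a : (Del `<=` Gam)%fset -> (Lam `<=` Gam)%fset ->
  (forall x y, e x y -> x \in Del -> (x \in Lam) && (y \in Lam)) ->
  local_alg iota Del a ->
  star (phase_op Lam) * phase_op Gam * a = a * (star (phase_op Lam) * phase_op Gam).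
Proof.
move=> sD sL edge la; rewrite (iota_diag_star A_lim) (iota_diag_widen A_lim sL).
rewrite -(iotaM A_lim) diag_opM; apply: (iota_diag_comm A_lim sD _ la) => w w' ww'.
rewrite !(phase_split sL) !mulrA !phase_unit !mul1r.
apply: eq_bigr => -[x y] /= /andP[/andP[xy _] xyL].
have xD : val x \notin Del by apply/negP => xD; case/negP: xyL; exact: edge xy xD.
have yx : e (val y) (val x) by rewrite (tree_sym e_tree).
have yD : val y \notin Del.
  by apply/negP => yD; case/negP: xyL; rewrite andbC; exact: edge yx yD.
by rewrite (ww' x xD) (ww' y yD).
Qed.

End Phases.

(** * Transition expectations and the Markov property *)

Section Markov.
Variables (R : realType) (L : countType) (e : rel L) (d : nat).
Variables (A : cstarAlgType R) (iota : forall Lam : {fset L}, bnd R d Lam -> A).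
Variables (psi : L -> L -> 'M[R[i]]_d) (phi : A -> R[i]).
Hypothesis d_gt0 : (0 < d)%N.
Hypothesis e_tree : is_tree e.
Hypothesis A_lim : is_inductive_limit iota.
Hypothesis psi_flat : forall x y i j, e x y -> `|psi x y i j| ^+ 2 = d%:R^-1.
Hypothesis phi_state : is_state [set: A] phi.
Hypothesis phi_lim : local_limit e psi iota phi.
Variable x0 : L.
Implicit Types Lam Gam Del : {fset L}.

Local Notation P := (mean_proj iota).
Local Notation U := (phase_op e iota psi).
Local Notation B n := (tree_ball e x0 n).

Lemma mean_compress Lam (X : bnd R d Lam) :
  mean_mx R d Lam *m X *m mean_mx R d Lam = 0 -> \sum_i \sum_j X i j = 0.
Proof.
move=> X0; have h : (0 < hdim d Lam)%N := hdim_gt0 d_gt0 Lam.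
have := congr1 (fun Y : 'M_(hdim d Lam) => Y (Ordinal h) (Ordinal h)) X0.
rewrite [X in _ = X]mxE mxE.
have -> : \sum_j (mean_mx R d Lam *m X) (Ordinal h) j * mean_mx R d Lam j (Ordinal h) =
    (hdim d Lam)%:R^-1 * (hdim d Lam)%:R^-1 * \sum_i \sum_j X i j.
  rewrite exchange_big mulr_sumr; apply: eq_bigr => j _.
  rewrite mxE mulr_suml mulr_sumr; apply: eq_bigr => i _.
  by rewrite !mxE mulrAC.
move=> /eqP; rewrite !mulf_eq0 !invr_eq0 (negPf (hdim_neq0 R d_gt0 Lam)) /=.
by move=> /eqP.
Qed.

(** The vector of the region Lam is proportional to the phase operator applied
    to the vector with equal coordinates, hence local observables that this
    vector compresses to 0 have vanishing expectation. *)
Lemma compress_inner Lam0 Lam (s : (Lam0 `<=` Lam)%fset) (m : bnd R d Lam0) :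
  P Lam * (star (U Lam) * iota m * U Lam) * P Lam = 0 ->
  inner (psi_vec e psi Lam) (tensor1 s m *m psi_vec e psi Lam) = 0.
Proof.
rewrite (iota_diag_star A_lim) -(iota_tensor1 A_lim s) /mean_proj -!(iotaM A_lim).
rewrite -(iota0 A_lim Lam) => /(iota_inj A_lim)/mean_compress.
have [c c0 cP] := phase_psi e psi d_gt0 Lam.
set t := tensor1 s m; set v := psi_vec e psi Lam.
have -> : \sum_i \sum_j (diag_op (fun w => Num.conj (phase e psi w)) *m t *m
    diag_op (@phase _ _ e _ psi Lam)) i j = Num.conj c * c * inner v (t *m v).
  rewrite /inner mxE mulr_sumr; apply: eq_bigr => i _.
  rewrite [X in _ * (X * _)]mxE [v^T _ _]mxE [(t *m v) _ _]mxE !mulr_sumr.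
  apply: eq_bigr => j _; rewrite /diag_op mul_mx_diag mul_diag_mx mxE [X in X * _]mxE.
  rewrite ![(\row__ _) _ _]mxE !cP rmorphM -/v; ring.
by move=> /eqP; rewrite !mulf_eq0 fmorph_eq0 (negPf c0) /= => /eqP.
Qed.

(** Local values of phi are limits over connected sets, and large balls are among
    these; that a limit vanishes does not depend on the normalization of psi_Lam. *)
Lemma state_eq0 a J : (\bigcup_Lam local_alg iota Lam) a ->
  (forall j, (J <= j)%N -> P (B j) * (star (U (B j)) * a * U (B j)) * P (B j) = 0) ->
  phi a = 0.
Proof.
move=> [Lam0 _ [m _ <-]] aj; apply/eqP; rewrite -normr_eq0; apply/eqP.
rewrite normc_def; congr (_%:C).
apply/eqP; rewrite eq_le sqrtr_ge0 andbT; apply/ler_addgt0Pr => eps eps0; rewrite add0r.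
have [Lam1 [_ s01] lim] := phi_lim m eps0.
have [n s1n] := tree_ball_exhaust e_tree x0 Lam1.
have s1 : (Lam1 `<=` B (maxn n J))%fset.
  by apply: fsubset_trans s1n _; apply: tree_ball_sub => //; exact: leq_maxl.
have s0 := fsubset_trans s01 s1.
have := lim _ s0 (@tree_ball_connected _ _ e_tree x0 _) s1.
rewrite compress_inner ?mulr0 ?sub0r ?normrN; last by apply: aj; exact: leq_maxr.
by rewrite normc_def ltcR => /ltW.
Qed.

Let f_pos := re_state_positive phi_state.

(** States are bounded, by the Cauchy-Schwarz inequality against 1. *)
Lemma re_state_le a : re_state phi a <= cnorm a.
Proof.
have := form1_le f_pos (1%:M : 'cV[A]_1) (a%:M : 'cV[A]_1).
rewrite /form !mulmx1 adj1 mul1mx mxE eqxx mulr1n => /le_trans; apply.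
have -> : qnorm (re_state phi) (1%:M : 'cV[A]_1) = 1.
  by rewrite (col_qnorm f_pos) big_ord1 mxE eqxx mulr1 star1 re_state1.
rewrite sqrtr1 mul1r (col_qnorm f_pos) big_ord1 mxE eqxx mulr1n.
have := positive_functional_bound f_pos 1 (lexx (cnorm a)).
rewrite !mulr1 star1 (re_state1 phi_state) mulr1 => /ler_wsqrtr.
by rewrite sqrtr_sqr ger0_norm ?cnorm_ge0.
Qed.

Lemma state_lim0 (u : nat -> A) a : cconv u a -> (forall n, phi (u n) = 0) -> phi a = 0.
Proof.
move=> ua u0; have le0 k : re_state phi (k *: a) <= 0.
  apply/ler_addgt0Pr => eps eps0; rewrite add0r.
  have ku : cconv (fun n => k%:A * u n) (k%:A * a) by apply: cconvM ua; exact: cconv_cst.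
  have [n un] := cconv_near eps0 ku.
  have -> : re_state phi (k *: a) = re_state phi (k%:A * a - k%:A * u n).
    rewrite /re_state -!scalerAl !mul1r (stateD phi_state) -scalerN (stateZ phi_state k (- _)).
    by rewrite -scaleN1r (stateZ phi_state (-1)) u0 !mulr0 addr0.
  by apply: le_trans (re_state_le _) _; rewrite cnorm_distC ltW.
have := le0 1; have := le0 (-1); have := le0 'i%C; have := le0 (- 'i%C).
rewrite /re_state !(stateZ phi_state); case: (phi a) => x y /=.
by move=> h1 h2 h3 h4; apply/eqP; rewrite eq_complex /=; apply/andP; split; apply/eqP; lra.
Qed.

(** All edges that meet the n-th ball lie in the (n+1)-st; undoing the phases of the
    latter in phi leaves a state in which the n-th ball is decoupled from its
    complement. *)
Definition hat_state n (b : A) : R[i] :=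
  phi (U (B n.+1) * b * star (U (B n.+1))).

(** The phases that are undone in the next state but not in the present one. *)
Definition transition n : A := star (U (B n.+1)) * U (B n.+2).

Definition expectation n (a : A) : A :=
  slice iota (B n.+1) (star (transition n) * a * transition n).

Lemma hat_state_is_state n (D : set A) : is_state D (hat_state n).
Proof.
split=> [k a b _ _||b _]; rewrite /hat_state.
- by rewrite mulrDr mulrDl -scalerAr -scalerAl (stateP phi_state).
- by rewrite mulr1 (phase_opVr d_gt0 A_lim psi_flat) (state_unit phi_state).
have := state_positive phi_state (b := b * star (U (B n.+1))) Logic.I.
by rewrite starM starK !mulrA.
Qed.

Lemma mean_star Lam : star (P Lam) = P Lam.
Proof.
rewrite /mean_proj -(iota_star A_lim); congr iota; apply/matrixP => i j; rewrite !mxE.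
by rewrite fmorphV rmorph_nat.
Qed.

Lemma transition_loc n : local_alg iota (B n.+2) (transition n).
Proof.
apply: (loc_mul A_lim); last exact: loc_phase_op.
apply: (loc_star A_lim); apply: (loc_mono A_lim); last exact: loc_phase_op.
exact: (tree_ball_subS e_tree).
Qed.

Lemma expectation_loc n b : (\bigcup_Lam local_alg iota Lam) b ->
  (\bigcup_Lam local_alg iota Lam) (expectation n b).
Proof.
move=> [Lam _ lb]; have lt := transition_loc n.
exists ((Lam `|` B n.+2) `\` B n.+1)%fset => //; apply: (slice_loc A_lim).
  apply: fsubset_trans (fsubsetUr _ _); exact: (tree_ball_subS e_tree).
have s1 := fsubsetUl Lam (B n.+2); have s2 := fsubsetUr Lam (B n.+2).
apply: (loc_mul A_lim); last exact: (loc_mono A_lim s2).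
apply: (loc_mul A_lim); last exact: (loc_mono A_lim s1).
by apply: (loc_star A_lim); exact: (loc_mono A_lim s2).
Qed.

(** Compressed by the projection of a large ball, in the frame of its phases,
    both arguments become the same element: compression by the mean projection
    turns the partial expectation into the identity, and the phases outside the
    (n+2)-nd ball commute with the projection of the (n+1)-st. *)
Lemma compress_expectation n j b : (n.+2 <= j)%N ->
  P (B j) * (star (U (B j)) * (U (B n.+2) * expectation n b * star (U (B n.+2))) *
             U (B j)) * P (B j) =
  P (B j) * (star (U (B j)) * (U (B n.+1) * b * star (U (B n.+1))) * U (B j)) *
  P (B j).
Proof.
move=> nj; set G := star (U (B n.+2)) * U (B j); set M := P (B n.+1); set V := transition n.
have s1 : (B n.+1 `<=` B j)%fset by apply: (tree_ball_sub e_tree); exact: ltnW.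
have s2 : (B n.+2 `<=` B j)%fset by exact: (tree_ball_sub e_tree).
have [PM MP] := mean_proj_sub A_lim d_gt0 s1.
have GM : G * M = M * G.
  apply: (phase_ratio_comm d_gt0 A_lim e_tree psi_flat s1 s2 _ (loc_mean _ _)).
  move=> x y xy xn.
  rewrite (tree_ball_edge e_tree xy xn) andbT.
  exact: (fsubsetP (tree_ball_subS e_tree _ _)).
have Ms : star M = M := mean_star _.
have GMs : star G * M = M * star G by rewrite -{1}Ms -{2}Ms -!starM GM.
have VG : V * G = star (U (B n.+1)) * U (B j).
  rewrite /V /transition /G mulrA -(mulrA (star _)) (phase_opVr d_gt0 A_lim psi_flat).
  by rewrite mulr1.
have E1 : P (B j) * star G = P (B j) * star G * M by rewrite -mulrA GMs mulrA PM.
have E2 : G * P (B j) = M * (G * P (B j)) by rewrite mulrA -GM -mulrA MP.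
transitivity (P (B j) * star G * expectation n b * (G * P (B j))).
  by rewrite /G starM starK !mulrA.
transitivity ((P (B j) * star G * M) * (star V * b * V) * (M * (G * P (B j)))).
  transitivity (P (B j) * star G * (M * (star V * b * V) * M) * (G * P (B j))).
    rewrite -(slice_compress A_lim d_gt0 (B n.+1)) -/(expectation n b) -/M.
    by rewrite [in LHS]E1 [in LHS]E2 !mulrA.
  by rewrite !mulrA.
rewrite -E1 -E2; transitivity (P (B j) * star (V * G) * b * (V * G) * P (B j)).
  by rewrite (starM V G) !mulrA.
by rewrite VG starM starK !mulrA.
Qed.

Lemma expectationP n (k : R[i]) a b :
  expectation n (k *: a + b) = k *: expectation n a + expectation n b.
Proof. by rewrite /expectation mulrDr mulrDl -scalerAr -scalerAl sliceP. Qed.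

(** Both sides are continuous in b, so b may be taken local; then [state_eq0] applies
    to the difference, which large balls compress to 0. *)
Lemma hat_state_expectation n b : hat_state n b = hat_state n.+1 (expectation n b).
Proof.
pose F a := U (B n.+1) * a * star (U (B n.+1)) -
            U (B n.+2) * expectation n a * star (U (B n.+2)).
suff F0 : phi (F b) = 0.
  move: F0; rewrite /F -scaleN1r (stateD phi_state) (stateZ phi_state) mulN1r.
  by move=> /eqP; rewrite subr_eq0 => /eqP.
have [u lu ub] := norm_closure_seq (loc_dense A_lim b).
have Fu : cconv (fun m => F (u m)) (F b).
  have sand (x y : A) v c : cconv v c -> cconv (fun m => x * v m * y) (x * c * y).
    by move=> vc; apply: cconvM (cconv_cst _); apply: cconvM => //; exact: cconv_cst.
  have Eu : cconv (fun m => expectation n (u m)) (expectation n b).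
    by apply: cconv_sum => k _; exact: (sand _ _ _ _ (sand _ _ _ _ ub)).
  have NE := cconvM (cconv_cst (-1)) (sand (U (B n.+2)) (star (U (B n.+2))) _ _ Eu).
  have := cconvD (sand (U (B n.+1)) (star (U (B n.+1))) _ _ ub) NE.
  rewrite mulN1r (_ : (fun m => _ + _) = fun m => F (u m)) //.
  by apply: funext => m; rewrite mulN1r.
apply: (state_lim0 Fu) => m; apply: (state_eq0 (J := n.+2)) => [|j nj].
  have [Lam _ lE] := expectation_loc n (lu m); have [Lam' _ l] := lu m.
  set Gam := (Lam `|` Lam' `|` B n.+1 `|` B n.+2)%fset; exists Gam => //.
  have lG Del a : (Del `<=` Gam)%fset -> local_alg iota Del a -> local_alg iota Gam a.
    by move=> s; apply: (loc_mono A_lim).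
  have UG k : (B k `<=` Gam)%fset -> local_alg iota Gam (U (B k)).
    by move=> s; apply: (lG _ _ s); exact: loc_phase_op.
  have s1 : (B n.+1 `<=` Gam)%fset.
    by apply/fsubsetP => x; rewrite !inE => ->; rewrite ?orbT.
  have s2 : (B n.+2 `<=` Gam)%fset.
    by apply/fsubsetP => x; rewrite !inE => ->; rewrite ?orbT.
  rewrite /F addrC -scaleN1r; apply: (loc_linear A_lim).
    apply: (loc_mul A_lim); last by apply: (loc_star A_lim); exact: UG.
    apply: (loc_mul A_lim); first exact: UG.
    by apply: lG lE; apply/fsubsetP => x; rewrite !inE => ->.
  apply: (loc_mul A_lim); last by apply: (loc_star A_lim); exact: UG.
  apply: (loc_mul A_lim); first exact: UG.
  by apply: lG l; apply/fsubsetP => x; rewrite !inE => ->; rewrite ?orbT.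
by rewrite /F mulrBr mulrBl mulrBr mulrBl compress_expectation // subrr.
Qed.

Lemma phase_op_ball1 : U (B 1%N) = 1.
Proof.
have := phase_opVl d_gt0 A_lim psi_flat (B 1%N).
rewrite /phase_op -(iota1 A_lim (B 1%N)) => _; congr iota.
apply/matrixP => i j; rewrite !mxE /phase big_pred0 // => -[x y] /=.
apply/negP => /andP[_].
have := valP x; have := valP y; rewrite !inE => /eqP -> /eqP ->.
by rewrite ltnn.
Qed.

Lemma hat_state_iter n a (E : nat -> A -> A) : (forall k, E k.+1 = expectation k) ->
  hat_state n (iter_qce E n a) = phi a.
Proof.
move=> EE; elim: n => [|n IH] /=; last by rewrite EE -hat_state_expectation.
by rewrite /hat_state phase_op_ball1 star1 mul1r mulr1.
Qed.

(** Complete positivity is the point that needs care: c^* c is mapped to a sum of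
    squares of matrices with entries outside the target algebra, and
    [sum_squares_square] rewrites it as one square over the target. *)
Lemma expectation_qce n : quasi_conditional_expectation
  (subalg iota (~` gclosure e (B n.+1))) (subalg iota (~` [set` B n.+1]))
  (subalg iota (~` [set` B n])) (expectation n).
Proof.
split.
- by move=> a _; exact: (slice_outside A_lim).
- by move=> k a b _ _; exact: expectationP.
- have V1 : star (transition n) * transition n = 1.
    rewrite /transition starM starK -mulrA (mulrA (U (B n.+1))).
    by rewrite (phase_opVr d_gt0 A_lim psi_flat) mul1r (phase_opVl d_gt0 A_lim psi_flat).
  by rewrite /expectation mulr1 V1 (slice1 A_lim d_gt0).
- move=> m a [c Dc ->].
  pose y (k : 'I_(hdim d (B n.+1))) : 'M[A]_m :=
    map_mx (fun x => x * (transition n * kraus iota k)) c.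
  have E : map_mx (expectation n) (map_mx star c^T *m c) = \sum_k adj (y k) *m y k.
    apply/matrixP => i j; rewrite mxE summxE mxE /expectation /slice.
    apply: eq_bigr => k _; rewrite mxE mulr_sumr mulr_suml mulr_sumr mulr_suml.
    apply: eq_bigr => l _; rewrite !mxE !starM !mulrA //.
  have BS i j : subalg iota (~` [set` B n.+1]) ((\sum_k adj (y k) *m y k) i j).
    by rewrite -E mxE; exact: (slice_outside A_lim).
  have [Z BZ ZE] := sum_squares_square f_pos (state_norm A_lim phi_state)
    (subalg_closed A_lim _) BS.
  by exists Z; rewrite // E ZE adjE.
- move=> c a Cc _; rewrite /expectation.
  have cV x : local_alg iota (B n.+2) x -> c * x = x * c.
    by apply: (subalg_comm A_lim _ Cc) => y yB; apply; exact: tree_ball_gclosure.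
  rewrite -(slice_mul_comm A_lim) => [|x lx].
    by rewrite !mulrA cV //; apply: (loc_star A_lim); exact: transition_loc.
  by apply: cV; apply: (loc_mono A_lim) lx; exact: tree_ball_subS.
Qed.

End Markov.

Theorem proposition5p7 (R : realType) (L : countType) (e : rel L) (d : nat)
    (A : cstarAlgType R) (iota : forall Lam : {fset L}, bnd R d Lam -> A)
    (psi : L -> L -> 'M[R[i]]_d) (phi : A -> R[i])
    (d_gt0 : (0 < d)%N)
    (e_tree : is_tree e)
    (A_lim : is_inductive_limit iota)
    (psi_ampl : is_amplitude e psi)
    (psi_flat : forall x y i j, e x y -> `|psi x y i j| ^+ 2 = d%:R^-1)
    (phi_state : is_state [set: A] phi)
    (phi_lim : local_limit e psi iota phi) :
  generalized_quantum_markov e iota phi.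
Proof.
have [x0] := tree_nonempty e_tree.
exists (tree_ball e x0).
exists (fun n => if n is k.+1 then expectation e iota psi x0 k else id).
exists (hat_state e iota psi phi x0); split.
- split=> //; [exact: tree_ball_subS | exact: tree_ball_cover | exact: tree_ballS].
- by move=> n; exact: (expectation_qce d_gt0 e_tree A_lim psi_flat phi_state).
- by move=> n; exact: (hat_state_is_state d_gt0 A_lim psi_flat phi_state).
- by move=> n a _; exact: (hat_state_expectation d_gt0 e_tree A_lim psi_flat phi_state phi_lim).
- move=> a.
  rewrite (_ : (fun n => _) = fun=> phi a); first exact: cvg_cst.
  by apply: funext => n; exact: (hat_state_iter d_gt0 e_tree A_lim psi_flat phi_state phi_lim).
Qed.
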